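(* Let $\mathcal{M}$ be an episodic MDP in which every state is reachable at every stage $h\in\{2,\dots,H\}$, i.e. $\max_{\pi\in\Pi^S}p_h^\pi(s)>0$ for all $s\in\mathcal{S}$ and $h\in\{2,\dots,H\}$. Let $\delta\in(0,1)$, let $c$ be a target function, and assume that the online learning algorithms $\mathcal{A}^\lambda$ and $\mathcal{A}^\Pi$ satisfy the first-order regret conditions (R1) and (R2) of the context, with non-decreasing functions $\mathcal{R}^\lambda(\cdot)$ and $\mathcal{R}^\Pi_\delta(\cdot)$. Then, with probability at least $1-\delta$, the algorithm CovGame run with inputs $(c,\delta)$ satisfies $n_h^\tau(s,a)\ge c_h(s,a)$ for all $(h,s,a)$, and its stopping time $\tau$ (number of episodes) satisfies $$\tau\ \le\ 64\,m\,\varphi^\star(c)+T_1,$$ where $m:=\lceil\log_2(c_{\max}/c_{\min})\rceil\vee 1$, $c_{\max}:=\max_{h,s,a}c_h(s,a)$, $c_{\min}:=\min_{(h,s,a)\in\mathcal{X}}c_h(s,a)\vee 1$, and $$T_1=\inf\Big\{T\in\mathbb{N}^*:\ \tfrac{T}{2}\ \ge\ m\,\varphi^\star(\mathbf{1}_{\mathcal{X}})\big(3\mathcal{R}^\Pi_{\delta/2}(T)+12\mathcal{R}^\lambda(T)+24\log(4T/\delta)\big)+1\Big\}.$$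
   Context: Setting. $\mathcal{M}=(\mathcal{S},\mathcal{A},\{p_h\}_{h\in[H]},s_1,H)$ is a finite-horizon MDP with finite $\mathcal{S},\mathcal{A}$ and unknown transitions. In each episode $t$ the learner plays a policy $\pi^t$ from $s_1$ and observes $(s_h^t,a_h^t)_{h\in[H]}$; $n_h^t(s,a)$ is the number of visits to $(s,a)$ at stage $h$ in the first $t$ episodes. $\Pi^S$ is the set of stochastic policies, $p_h^\pi(s,a)$, $p_h^\pi(s)$ are the state-action and state visitation probabilities at stage $h$ under $\pi$, and $\Omega=\{p^\pi:\pi\in\Pi^S\}$. A target function is a map $c:[H]\times\mathcal{S}\times\mathcal{A}\to\mathbb{R}$; $\mathcal{X}=\{(h,s,a):c_h(s,a)>0\}$. For a target function $c$, $\varphi^\star(c)=\inf_{\rho\in\Omega}\max_{(h,s,a):c_h(s,a)>0}c_h(s,a)/\rho_h(s,a)$. $\mathbf{1}_{\mathcal{X}}$ is the indicator function of $\mathcal{X}$ and $\mathcal{P}(\mathcal{X})$ the set of probability distributions on $\mathcal{X}$. For a reward function $\lambda$ on $[H]\times\mathcal{S}\times\mathcal{A}$, $V_1^\pi(s_1;\lambda)=\sum_{h,s,a}p_h^\pi(s,a)\lambda_h(s,a)$ and $V_1^\star(s_1;\lambda)=\max_\pi V_1^\pi(s_1;\lambda)$. Let $\mathcal{X}_0=\mathcal{X}$ and $\mathcal{X}_k=\{(h,s,a):c_h(s,a)>c_{\min}2^k\}$ for $k\ge 1$. Regret conditions. (R1) $\mathcal{A}^\lambda$ is an online algorithm which,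 when instantiated on $\mathcal{P}(\mathcal{X}_k)$ for some $k$ and fed with a sequence of linear losses $\ell^t$ bounded in $[0,1]$ (each revealed after playing $\lambda^t$), outputs $\lambda^t\in\mathcal{P}(\mathcal{X}_k)$ with, for all $T\in\mathbb{N}^*$, $$\sum_{t=1}^T\ell^t(\lambda^t)-\min_{\lambda\in\mathcal{P}(\mathcal{X}_k)}\sum_{t=1}^T\ell^t(\lambda)\le\sqrt{\mathcal{R}^\lambda(T)\sum_{t=1}^T\ell^t(\lambda^t)}+\mathcal{R}^\lambda(T).$$ (R2) $\mathcal{A}^\Pi$ is an RL algorithm which receives at the beginning of each episode $t$ a reward function $\lambda^t\in\mathcal{P}(\mathcal{X})$ and outputs a policy $\pi^t$ to play; if run with confidence $1-\delta$, then with probability at least $1-\delta$, for all $T\in\mathbb{N}^*$, $$\sum_{t=1}^TV_1^\star(s_1;\lambda^t)-\sum_{t=1}^TV_1^{\pi^t}(s_1;\lambda^t)\le\sqrt{\mathcal{R}^\Pi_\delta(T)\sum_{t=1}^TV_1^{\pi^t}(s_1;\lambda^t)}+\mathcal{R}^\Pi_\delta(T).$$ Algorithm CovGame$(c,\delta)$. Initialize $n^0=0$, $k_1=0$, instantiate $\mathcal{A}^\lambda$ on $\mathcal{P}(\mathcal{X})$ and let $\lambda^1$ be uniform on $\mathcal{X}$. For $t=1,2,\dots$: (i) get $\pi^t$ from $\mathcal{A}^\Pi$ given reward $\lambda^t$, run with confidence $1-\delta/2$ (never reset); (ii) play $\pi^t$ for one episode and update the counts to $n^t$; (iii) if $n_h^t(s,a)\ge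 c_h(s,a)$ for all $(h,s,a)$, stop, set $\tau=t$ and return all sampled trajectories; (iv) set $k_{t+1}=\max\{j\in\mathbb{N}:n_h^t(s,a)\ge c_h(s,a)\ \forall(h,s,a)\in\mathcal{X}\setminus\mathcal{X}_j\}$; (v) if $k_{t+1}\ne k_t$, reset $\mathcal{A}^\lambda$ on $\mathcal{P}(\mathcal{X}_{k_{t+1}})$ and let $\lambda^{t+1}$ be uniform on $\mathcal{X}_{k_{t+1}}$; otherwise feed $\mathcal{A}^\lambda$ the loss $\ell^t(\lambda)=\sum_{(h,s,a)\in\mathcal{X}_{k_t}}\lambda_h(s,a)\mathbf{1}(s_h^t=s,a_h^t=a)$ and get $\lambda^{t+1}$ from it.
   Formalization: The formal theorem additionally assumes that the inequality defining T_1, once true for some T ≥ 1, stays true for every larger T; with merely non-decreasing regret functions the claim fails. Coverage at τ is asserted when τ is finite. *)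

(* Defs.v *)
From HB Require Import structures.
From mathcomp Require Import all_boot all_order all_algebra.
From mathcomp Require Import all_classical all_reals all_analysis.
Import Order.TTheory GRing.Theory Num.Theory.

Set Implicit Arguments.
Unset Strict Implicit.
Unset Printing Implicit Defensive.

Local Open Scope classical_set_scope.
Local Open Scope ring_scope.

(* Stages 1, ..., H are represented by the ordinals 0, ..., H-1. *)

Record mdp (R : realType) (H : nat) (S A : finType) := MDP {
  init : S;
  trans : 'I_H -> S -> A -> S -> R;
  trans_ge0 : forall h s a s', 0 <= trans h s a s';
  trans_sum1 : forall h s a, \sum_s' trans h s a s' = 1 }.

Record policy (R : realType) (H : nat) (S A : finType) := Policy {
  pol :> 'I_H -> S -> A -> R;
  pol_ge0 : forall h s a, 0 <= pol h s a;
  pol_sum1 : forall h s, \sum_a pol h s a = 1 }.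

Notation hsa H S A := ('I_H * S * A)%type.
Notation traj H S A := {ffun 'I_H -> S * A}.

(* Real vectors indexed by [H] x S x A: rewards, distributions, and linear
   losses (identified with their coefficients). *)
Notation vec R H S A := {ffun hsa H S A -> R}.

Section MDPTheory.
Context {R : realType} {H : nat} {S A : finType}.
Variable M : mdp R H S A.
Implicit Types (pi : policy R H S A) (z : traj H S A) (x : hsa H S A).

Definition visits z x : bool := z x.1.1 == (x.1.2, x.2).

(* Law of the trajectory of one episode; for h > 0, ord_pred h is h - 1. *)
Definition traj_prob pi z : R :=
  \prod_(h < H)
    ((if h == 0 :> nat then ((z h).1 == init M)%:R
      else trans M (ord_pred h) (z (ord_pred h)).1 (z (ord_pred h)).2 (z h).1)
     * pi h (z h).1 (z h).2).

Definition occ pi x : R := \sum_(z : traj H S A | visits z x) traj_prob pi z.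

Definition occ_state pi (h : 'I_H) (s : S) : R :=
  \sum_(z : traj H S A | (z h).1 == s) traj_prob pi z.

Definition value pi (lam : vec R H S A) : R := \sum_x occ pi x * lam x.

Definition opt_value (lam : vec R H S A) : R :=
  sup [set value pi lam | pi in [set: policy R H S A]].

(* The ratio is +oo where c is positive and the occupancy is zero. *)
Definition coverage (c : hsa H S A -> R) : \bar R :=
  ereal_inf [set \big[Order.max/0%E]_(x | 0 < c x) ((c x)%:E / (occ pi x)%:E)%E
            | pi in [set: policy R H S A]].

End MDPTheory.

Section Targets.
Context {R : realType} {H : nat} {S A : finType}.
Variable c : hsa H S A -> R.

Definition supp : {set hsa H S A} := [set x | 0 < c x].

Definition supp_ind : hsa H S A -> R := fun x => (x \in supp)%:R.

Definition cmax : R := sup (range c).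

Definition cmin : R := Num.max (inf [set c x | x in [set x | x \in supp]]) 1.

Definition level (k : nat) : {set hsa H S A} :=
  if k is 0 then supp else [set x | cmin * 2 ^+ k < c x].

Definition nphases : int := Num.max (Num.ceil (ln (cmax / cmin) / ln 2)) 1.

Definition is_dist (Y : {set hsa H S A}) (lam : vec R H S A) : Prop :=
  [/\ forall x, 0 <= lam x, forall x, x \notin Y -> lam x = 0
    & \sum_x lam x = 1].

Definition uniform (Y : {set hsa H S A}) : vec R H S A :=
  [ffun x => (x \in Y)%:R / #|Y|%:R].

Definition loss_val (l lam : vec R H S A) : R := \sum_x lam x * l x.

End Targets.

(* An online linear optimization algorithm: given the set Y on which it is
   instantiated and the losses revealed so far, it outputs the next point of
   P(Y). Linear losses on P(Y) are given by coefficients vanishing off Y. *)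
Definition online_algo (R : realType) (H : nat) (S A : finType) :=
  {set hsa H S A} -> seq (vec R H S A) -> vec R H S A.

(* An RL algorithm, possibly randomized through a seed in U: it maps the
   confidence parameter, the seed, the past (reward, trajectory) pairs and the
   current reward to the policy to play. *)
Definition rl_algo (R : realType) (H : nat) (S A : finType) (U : Type) :=
  R -> U -> seq (vec R H S A * traj H S A) -> vec R H S A -> policy R H S A.

Definition measurable_rl_algo (R : realType) (H : nat) (S A : finType)
    (dU : measure_display) (U : measurableType dU) (AP : rl_algo R H S A U) :=
  forall delta past lam h s a,
    measurable_fun [set: U] (fun u => AP delta u past lam h s a).

(* For a measurable event E this is p <= P E. *)
Definition with_prob_ge (R : realType) (d : measure_display)
    (T : measurableType d) (P : probability T R) (p : R) (E : set T) : Prop :=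
  exists F : set T, [/\ measurable F, F `<=` E & (p%:E <= P F)%E].

Section OnlineRegret.
Context {R : realType} {H : nat} {S A : finType}.

(* The t-th round (from 0) plays Al Y [:: l 0; ...; l t.-1]. *)
Definition online_regret (c : hsa H S A -> R) (Al : online_algo R H S A)
    (Rl : nat -> R) : Prop :=
  forall (k : nat) (l : nat -> vec R H S A),
    let Y := level c k in
    let lam t := Al Y (mkseq l t) in
    Y != finset.set0 ->
    (forall t x, x \notin Y -> l t x = 0) ->
    (forall t mu, is_dist Y mu -> 0 <= loss_val (l t) mu <= 1) ->
    (forall t, is_dist Y (lam t)) /\
    forall T, (0 < T)%N ->
      let L := \sum_(t < T) loss_val (l t) (lam t) in
      L - inf [set \sum_(t < T) loss_val (l t) mu | mu in is_dist Y]
        <= Num.sqrt (Rl T * L) + Rl T.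

End OnlineRegret.

Section Interaction.
Context {R : realType} {H : nat} {S A : finType}.
Context {dU : measure_display} {U : measurableType dU}.
Variables (M : mdp R H S A) (nu : probability U R).
Variables (AP : rl_algo R H S A U) (delta : R).

(* A rule choosing the reward of the next episode from the trajectories of the
   previous ones, in chronological order. *)
Variable rew : seq (traj H S A) -> vec R H S A.

(* z i is the trajectory of episode i+1, and played u z t the policy of
   episode t+1. *)
Definition played (u : U) (z : nat -> traj H S A) (t : nat) : policy R H S A :=
  AP delta u (mkseq (fun i => (rew (mkseq z i), z i)) t) (rew (mkseq z t)).

(* xi (the seed, of law nu) and z are a realization, on (T, P), of AP run on M
   with the rewards rew: given the seed and the first t trajectories, the next
   one is drawn from M under the policy played. *)
Definition is_run (d : measure_display) (T : measurableType d)
    (P : probability T R) (xi : T -> U) (z : nat -> T -> traj H S A) : Prop :=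
  [/\ measurable_fun [set: T] xi,
      forall i w, measurable (z i @^-1` [set w])
    & forall (B : set U) (t : nat) (w : nat -> traj H S A), measurable B ->
        P (xi @^-1` B `&` [set o | forall i, (i < t)%N -> z i o = w i]) =
        (\int[nu]_(u in B)
          (\prod_(i < t) traj_prob M (played u w i) (w i))%:E)%E].

End Interaction.

Definition rl_regret (R : realType) (H : nat) (S A : finType)
    (dU : measure_display) (U : measurableType dU)
    (M : mdp R H S A) (c : hsa H S A -> R)
    (nu : probability U R) (AP : rl_algo R H S A U)
    (delta : R) (RP : nat -> R) : Prop :=
  forall (d : measure_display) (T : measurableType d) (P : probability T R)
    (xi : T -> U) (z : nat -> T -> traj H S A)
    (rew : seq (traj H S A) -> vec R H S A),
    (forall s, is_dist (supp c) (rew s)) ->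
    is_run M nu AP delta rew P xi z ->
    with_prob_ge P (1 - delta) [set o | forall n, (0 < n)%N ->
      let lam t := rew (mkseq (z^~ o) t) in
      let V := \sum_(t < n)
                 value M (played AP delta rew (xi o) (z^~ o) t) (lam t) in
      \sum_(t < n) opt_value M (lam t) - V <= Num.sqrt (RP n * V) + RP n].

Section CovGame.
Context {R : realType} {H : nat} {S A : finType}.
Variables (c : hsa H S A -> R) (Al : online_algo R H S A).

Definition visit_count (s : seq (traj H S A)) (x : hsa H S A) : nat :=
  count (visits^~ x) s.

Definition covered (s : seq (traj H S A)) : Prop :=
  forall x, c x <= (visit_count s x)%:R.

(* The set of j is bounded as long as s is not covered. *)
Definition next_phase (s : seq (traj H S A)) : nat :=
  let J := [set j | forall x, x \in supp c :\: level c j ->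
                      c x <= (visit_count s x)%:R] in
  xget 0%N [set k | J k /\ forall j, J j -> (j <= k)%N].

Record cg_state := CGState {
  cg_hist : seq (traj H S A);
  cg_phase : nat;
  cg_losses : seq (vec R H S A);   (* fed to Al since its last reset *)
  cg_lam : vec R H S A }.

Definition cg_init : cg_state := CGState [::] 0 [::] (uniform (supp c)).

Definition cg_loss (k : nat) (z : traj H S A) : vec R H S A :=
  [ffun x => ((x \in level c k) && visits z x)%:R].

(* Once the target is covered the algorithm has stopped; keeping the last reward
   from then on only serves to have a reward rule defined on all sequences. *)
Definition cg_step (st : cg_state) (z : traj H S A) : cg_state :=
  let: CGState s k ls lam := st in
  let s' := rcons s z in
  if `[< covered s' >] then CGState s' k ls lam
  else
    let k' := next_phase s' in
    if k' != k then CGState s' k' [::] (uniform (level c k'))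
    else let ls' := rcons ls (cg_loss k z) in
         CGState s' k ls' (Al (level c k) ls').

Definition covgame (s : seq (traj H S A)) : vec R H S A :=
  cg_lam (foldl cg_step cg_init s).

(* +oo when the algorithm does not stop. *)
Definition stop_time (z : nat -> traj H S A) : \bar R :=
  ereal_inf [set t%:R%:E | t in [set t | (0 < t)%N /\ covered (mkseq z t)]].

End CovGame.

Section T1.
Context {R : realType} {H : nat} {S A : finType}.
Variables (M : mdp R H S A) (c : hsa H S A -> R) (delta : R).
Variables (Rl RP : nat -> R).

Definition T1_cond (n : nat) : Prop :=
  ((nphases c)%:~R%:E * coverage M (supp_ind c)
     * (3 * RP n + 12 * Rl n + 24 * ln (4 * n%:R / delta))%:E + 1
   <= (n%:R / 2)%:E)%E.

(* The first n >= 1 satisfying T1_cond, +oo if there is none. Monotonicity of Rl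
   and RP alone does not make T1_cond persist for larger n. *)
Definition T1 : \bar R :=
  ereal_inf [set n%:R%:E | n in [set n | (0 < n)%N /\ T1_cond n]].

End T1.

(* Main.v *)
Require Import Defs.
From HB Require Import structures.
From mathcomp Require Import all_boot all_order all_algebra.
From mathcomp Require Import all_classical all_reals all_analysis.
From mathcomp Require Import measurable_realfun ring lra zify.
Import Order.TTheory GRing.Theory Num.Theory.

Set Implicit Arguments.
Unset Strict Implicit.
Unset Printing Implicit Defensive.

Local Open Scope classical_set_scope.
Local Open Scope ring_scope.

(** Let [v_k] be the largest value of [min_(x in X_k) p^pi(x)] over policies.
It is nondecreasing in [k] and bounds [V*(lambda^t)] from below while the phase
is [k], and [b <= v_k phi*(c)] as soon as [b <= c] on [X_k].

For every number [n] of episodes before the target is covered, the regret of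
the RL algorithm, the deviation of the collected rewards from their conditional
means and the regret of the online algorithm in each phase give
[sum_(t <= n) v_(k_t) <= sum_(phases k started) 12 v_k phi*(c) + D], where [D]
collects the lower order terms. The comparator in phase [k] is the point mass at
an uncovered element of [X_k \ X_(k+1)], which has been visited at most
[c_min 2^(k+1)] times. As this holds for every [n] and [v] is nondecreasing,
Abel summation removes the weights:
[n <= 12 m phi*(c) + D / v_0 <= 12 m phi*(c) + D phi*(1_X)], and the definition
of [T_1] bounds the last term by [n / 2 - 1].

The deviation bound is Markov's inequality for the exponential of
[sum_t (V_t / 2 - y_t)], whose mean is at most 1 because
[exp (- y) <= 1 - y / 2] on [[0, 1]], followed by a union bound over [n] with
weights [1 / (n (n + 1))]. Since the law of a run is given by an integral of
products of trajectory probabilities, the mean is computed by summing over all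
finite sequences of trajectories, for a fixed seed. *)

(** * Preliminaries *)

Lemma val_ord_pred n (h : 'I_n) : (0 < h)%N -> ord_pred h = h.-1 :> nat.
Proof. by case: h => -[|j] jn //= _; rewrite modnDr modn_small// ltnW. Qed.

Lemma sum_point (R : pzRingType) (I : finType) (y : I) (F : I -> R) : \sum_x (x == y)%:R * F x = F y.
Proof.
rewrite (bigD1 y)//= eqxx mul1r big1 ?addr0// => x /negPf ->.
by rewrite mul0r.
Qed.

Lemma big_rcons_tuple (R : nmodType) (X : finType) n (F : n.+1.-tuple X -> R) :
  \sum_(t : n.+1.-tuple X) F t =
  \sum_(t : n.-tuple X) \sum_(x : X) F [tuple of rcons t x].
Proof.
rewrite pair_big /= (reindex (fun p : n.-tuple X * X => [tuple of rcons p.1 p.2])) //=.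
exists (fun t : n.+1.-tuple X => ([tuple of belast (thead t) (behead t)],
                                  last (thead t) (behead t))).
- move=> [t x] _ /=; congr pair.
  + apply: val_inj => /=; rewrite /thead (tnth_nth x)/=.
    by case: t => -[|y t] //= _; rewrite belast_rcons.
  + by rewrite /thead (tnth_nth x)/=; case: t => -[|y t] //= _; rewrite last_rcons.
- move=> t _; apply: val_inj => /=.
  by rewrite -lastI; case: t => -[|y t].
Qed.

(** Each factor looks only at coordinates up to its own index, so the last coordinate can be summed
    out first. This serves for the stages of an episode and for the episodes of a run. *)
Lemma sum_prod_adapted_le1 (R : realDomainType) (X : finType) (x0 : X)
    (g : nat -> (nat -> X) -> R)
    (gE : forall i w w', (forall j, (j <= i)%N -> w j = w' j) -> g i w = g i w')
    (g_ge0 : forall i w, 0 <= g i w)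
    (g_sum : forall i w, \sum_x g i (fun j => if j == i then x else w j) <= 1)
    n : \sum_(t : n.-tuple X) \prod_(i < n) g i (nth x0 t) <= 1.
Proof.
elim: n => [|n IHn].
  rewrite (eq_bigr (fun=> 1)) => [|t _]; last by rewrite big_ord0.
  by rewrite sumr_const card_tuple expn0.
rewrite big_rcons_tuple (le_trans _ IHn)//; apply: ler_sum => t _.
rewrite (eq_bigr (fun x => \prod_(i < n) g i (nth x0 t) *
    g n (fun j => if j == n then x else nth x0 t j))); last first.
  move=> x _; rewrite big_ord_recr/=; congr (_ * _).
    apply: eq_bigr => i _; apply: gE => j ji.
    by rewrite nth_rcons size_tuple (leq_ltn_trans ji (ltn_ord i)).
  apply: gE => j jn; rewrite nth_rcons size_tuple.
  by move: jn; rewrite leq_eqVlt; case: (ltngtP j n).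
rewrite -mulr_sumr ler_piMr//; exact: prodr_ge0.
Qed.

(** AM-GM, used to make the first-order regret bounds linear. *)
Lemma sqrtr_mul_le (R : rcfType) (a b : R) : 0 <= a -> 0 <= b -> Num.sqrt (a * b) <= a / 2 + b / 2.
Proof.
move=> a0 b0; rewrite -[leRHS]ger0_norm ?addr_ge0 ?divr_ge0// -sqrtr_sqr.
apply: ler_wsqrtr; have := sqr_ge0 (a - b); lra.
Qed.

Lemma ln4_ge1 (R : realType) : 1 <= ln 4 :> R.
Proof.
have h : 1 / 2 <= expR (- (1 / 2)) :> R by apply: le_trans (expR_ge1Dx _); lra.
have e4 : expR 1 <= 4 :> R.
  have -> : expR 1 = (expR (- (1 / 2)) * expR (- (1 / 2)))^-1 :> R.
    by rewrite -expRD -expRN; congr expR; lra.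
  rewrite -[leRHS]invrK lef_pV2 ?posrE ?mulr_gt0 ?expR_gt0//.
  by apply: le_trans (ler_pM _ _ h h); lra.
by rewrite -[leLHS]expRK ler_ln ?posrE ?expR_gt0.
Qed.

(** [expR y] is at least [1 + y], and [(1 + y) * (1 - y / 2)] is at least 1 on the unit interval. *)
Lemma expRN_le_half (R : realType) (y : R) : 0 <= y <= 1 -> expR (- y) <= 1 - y / 2.
Proof.
move=> /andP[y0 y1]; rewrite expRN -[leRHS]invrK lef_pV2 ?posrE ?expR_gt0 ?invr_gt0//.
  apply: le_trans (expR_ge1Dx y).
  rewrite -[leLHS]mul1r ler_pdivrMr; nra.
lra.
Qed.

(** The [d t] may be negative, so the bound on the last prefix alone would not suffice. [key]
    carries along the nonnegative slack of each prefix, which only shrinks when divided by a later,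
    larger weight. *)
Lemma sum_le_of_weighted (R : realFieldType) (v d : nat -> R) D n :
  0 <= D -> 0 < v 0%N -> (forall i, (i.+1 < n)%N -> v i <= v i.+1) ->
  (forall i, (i <= n)%N -> \sum_(t < i) d t * v t <= D) ->
  \sum_(t < n) d t <= D / v 0%N.
Proof.
move=> D0 v0 vmono dD.
case: n vmono dD => [|n] vmono dD; first by rewrite big_ord0 divr_ge0// ltW.
have vpos i : (i <= n)%N -> 0 < v i.
  by elim: i => // i IHi iN; rewrite (lt_le_trans (IHi (ltnW iN)))// vmono.
(* Abel summation *)
have key i : (i <= n)%N ->
    \sum_(t < i.+1) d t <= D / v 0%N - (D - \sum_(t < i.+1) d t * v t) / v i.
  elim: i => [_|i IHi iN].
    by rewrite !big_ord_recr !big_ord0/= !add0r mulrBl opprB addrCA subrr addr0 mulfK ?gt_eqF.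
  rewrite !(big_ord_recr i.+1)/=; have := IHi (ltnW iN).
  move: (dD i.+1 (leqW iN)) (vmono i iN) (vpos i (ltnW iN)) (vpos i.+1 iN).
  move: (\sum_(t < _) d t) (\sum_(t < _) _) (d i.+1) (v i.+1) (v i) (D / v 0%N).
  move=> s1 s2 e w' w q s2D ww' w0 w'0 s1q.
  have -> : (D - (s2 + e * w')) / w' = (D - s2) / w' - e by field; rewrite gt_eqF.
  have : (D - s2) / w' <= (D - s2) / w.
    by rewrite ler_wpM2l ?subr_ge0// lef_pV2.
  by move: (_ / _) (_ / _) s1q => *; lra.
apply: le_trans (key n (leqnn n)) _; rewrite gerBl divr_ge0 ?subr_ge0 ?dD//.
by rewrite ltW// vpos.
Qed.

(** Opens the infima defining [stop_time] and [T1] to case analysis. *)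
Lemma ereal_inf_natP (R : realType) (Q : nat -> Prop) :
  let I : \bar R := ereal_inf [set n%:R%:E | n in Q] in
  (I = +oo%E /\ forall n, ~ Q n) \/ exists n, [/\ Q n, I = n%:R%:E & forall j, Q j -> (n <= j)%N].
Proof.
move=> I; have [[n0 Qn0]|nQ] := pselect (exists n, Q n); last first.
  left; split; last by move=> n Qn; apply: nQ; exists n.
  rewrite /I (_ : [set _ | _ in Q] = set0) ?ereal_inf0//.
  by apply/seteqP; split=> // y [n Qn _]; apply: nQ; exists n.
right; have exQ : exists n, `[< Q n >] by exists n0; exact/asboolP.
have [n /asboolP Qn nmin] := ex_minnP exQ.
have nmin' j : Q j -> (n <= j)%N by move=> /asboolP; exact: nmin.
exists n; split=> //; apply/eqP; rewrite eq_le; apply/andP; split.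
  by apply: ereal_inf_lbound; exists n.
by apply: le_ereal_inf_tmp => _ [j Qj <-]; rewrite lee_fin ler_nat nmin'.
Qed.

Lemma measure_bigsetU_le d (T : measurableType d) (R : realType)
    (mu : {measure set T -> \bar R}) (I : Type) (r : seq I) (F : I -> set T) :
  (forall i, measurable (F i)) ->
  (mu (\big[setU/set0]_(i <- r) F i) <= \sum_(i <- r) mu (F i))%E.
Proof.
move=> mF; elim: r => [|i r IHr]; first by rewrite !big_nil measure0.
rewrite !big_cons; apply: le_trans (measureU2 _ _ _) _ => //.
  exact: bigsetU_measurable.
exact: leeD2l.
Qed.

Lemma with_prob_geI (R : realType) d (T : measurableType d) (P : probability T R)
    (p q : R) (E F G : set T) :
  with_prob_ge P (1 - p) E -> with_prob_ge P (1 - q) F -> E `&` F `<=` G ->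
  with_prob_ge P (1 - (p + q)) G.
Proof.
move=> [E' [mE EE pE]] [F' [mF FF qF]] EFG; exists (E' `&` F'); split.
- exact: measurableI.
- by move=> om [/EE Eom /FF Fom]; apply: EFG.
- have mEF : measurable (E' `&` F') by exact: measurableI.
  have fin (B : set T) : measurable B -> P B = (fine (P B))%:E.
    by move=> mB; rewrite fineK// fin_num_measure.
  have : (P (~` (E' `&` F')) <= P (~` E') + P (~` F'))%E.
    by rewrite setCI; apply: measureU2; exact: measurableC.
  move: pE qF; rewrite !probability_setC// (fin _ mE) (fin _ mF) (fin _ mEF).
  rewrite -!EFinB -EFinD !lee_fin; move: (fine _) (fine _) (fine _) => *; lra.
Qed.

(** * Occupancies and rewards in a finite-horizon MDP *)

Section MDP.
Context {R : realType} {H : nat} {S A : finType} (M : mdp R H S A).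
Implicit Types (pi : policy R H S A) (w : traj H S A) (lam : vec R H S A).
Implicit Types (Y Z : {set hsa H S A}).

Lemma traj_prob_ge0 pi w : 0 <= traj_prob M pi w.
Proof.
apply: prodr_ge0 => h _; apply: mulr_ge0; last exact: pol_ge0.
by case: ifP => _; [exact: ler0n|exact: trans_ge0].
Qed.

Lemma sum_traj_prob_le1 pi (x0 : S * A) : \sum_w traj_prob M pi w <= 1.
Proof.
(* Past the horizon [g] is a point mass at [x0], so that every index meets the conditions of
   [sum_prod_adapted_le1]. *)
pose g (i : nat) (w : nat -> S * A) : R := if (insub i : option 'I_H) is Some h then
    (if h == 0 :> nat then ((w h).1 == init M)%:R
      else trans M (ord_pred h) (w (ord_pred h)).1 (w (ord_pred h)).2 (w h).1)
     * pol pi h (w h).1 (w h).2 else (w i == x0)%:R.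
have -> : \sum_w traj_prob M pi w =
    \sum_(t : H.-tuple (S * A)) \prod_(i < H) g i (nth x0 t).
  rewrite (reindex (@finfun_of_tuple (S * A)%type H)) /=; last first.
    exists (@tuple_of_finfun (S * A)%type H) => x _;
      [exact: finfun_of_tupleK|exact: tuple_of_finfunK].
  apply: eq_bigr => t _; apply: eq_bigr => h _; rewrite /g valK.
  by rewrite /finfun_of_tuple !ffunE !(tnth_nth x0).
apply: sum_prod_adapted_le1.
- move=> i w w' ww'; rewrite /g; case: insubP => [h _ hi|_]; last by rewrite ww'.
  rewrite ww' ?hi//; case: ifPn => // i0.
  have h0 : (0 < h)%N by rewrite hi lt0n.
  by rewrite ww' // val_ord_pred// -hi leq_pred.
- move=> i w; rewrite /g; case: insubP => [h _ hi|_]; last exact: ler0n.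
  apply: mulr_ge0; last exact: pol_ge0.
  by case: ifP => _; [exact: ler0n|exact: trans_ge0].
- move=> i w; rewrite /g; case: insubP => [h iH hi|_]; last first.
    rewrite eqxx (bigD1 x0)//= eqxx big1 ?addr0// => x /negPf ->; done.
  rewrite hi eqxx; have [i0|i0] := boolP (i == 0%N).
    rewrite -(pair_bigA _ (fun s a => (s == init M)%:R * pol pi h s a))/=.
    under eq_bigr do rewrite -mulr_sumr pol_sum1 mulr1.
    rewrite (bigD1 (init M))//= eqxx big1 ?addr0// => x /negPf ->; done.
  have /negPf -> : nat_of_ord (ord_pred h) != i.
    have h0 : (0 < h)%N by rewrite hi lt0n.
    by rewrite val_ord_pred// hi neq_ltn prednK -?hi// leqnn.
  set p := trans M _ _ _.
  rewrite -(pair_bigA _ (fun s a => p s * pol pi h s a))/=.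
  under eq_bigr do rewrite -mulr_sumr pol_sum1 mulr1.
  by rewrite trans_sum1.
Qed.

(** The reward collected along one trajectory: its mean is [value], and on the current level it is
    the loss fed to the online algorithm. *)
Definition gain lam w : R := \sum_x lam x * (visits w x)%:R.

Lemma occ_ge0 pi x : 0 <= occ M pi x.
Proof. by apply: sumr_ge0 => w _; exact: traj_prob_ge0. Qed.

Lemma occ_le1 pi x : occ M pi x <= 1.
Proof.
apply: le_trans (sum_traj_prob_le1 pi (x.1.2, x.2)).
rewrite [leRHS](bigID (visits^~ x))/= lerDl.
by apply: sumr_ge0 => w _; exact: traj_prob_ge0.
Qed.

Lemma value_gain pi lam : value M pi lam = \sum_w traj_prob M pi w * gain lam w.
Proof.
under eq_bigr do rewrite mulr_sumr.
rewrite exchange_big /=; apply: eq_bigr => x _.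
rewrite /occ big_mkcond/= mulr_suml; apply: eq_bigr => w _.
by case: (visits w x); rewrite ?mulr1 ?mulr0 ?mul0r.
Qed.

Lemma value_ge0 pi lam : (forall x, 0 <= lam x) -> 0 <= value M pi lam.
Proof. by move=> l0; apply: sumr_ge0 => x _; rewrite mulr_ge0// occ_ge0. Qed.

Lemma gain_ge0 {Y} lam w : is_dist Y lam -> 0 <= gain lam w.
Proof. by case=> l0 _ _; apply: sumr_ge0 => x _; rewrite mulr_ge0. Qed.

Lemma gain_le1 {Y} lam w : is_dist Y lam -> gain lam w <= 1.
Proof.
case=> l0 _ <-; apply: ler_sum => x _.
by case: visits; rewrite ?mulr1 ?mulr0.
Qed.

Lemma value_le1 {Y} pi lam : is_dist Y lam -> value M pi lam <= 1.
Proof.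
case=> l0 _ <-; apply: ler_sum => x _.
by rewrite ler_piMl// occ_le1.
Qed.

Lemma value_le_opt {Y} pi lam : is_dist Y lam -> value M pi lam <= opt_value M lam.
Proof.
move=> ld; apply: ub_le_sup; last by exists pi.
by exists 1 => _ [p _ <-]; exact: value_le1 ld.
Qed.

(* Occupancies are at most 1, so the default value 1 only matters for empty [Z],
   where it keeps [max_min_occ] antitone. *)
Definition min_occ Z pi : R := \big[Num.min/1]_(x in Z) occ M pi x.

Definition max_min_occ Z : R :=
  sup [set min_occ Z pi | pi in [set: policy R H S A]].

Lemma min_occ_le Z pi x : x \in Z -> min_occ Z pi <= occ M pi x.
Proof. exact: bigmin_le_cond. Qed.

Lemma min_occ_ge0 Z pi : 0 <= min_occ Z pi.
Proof. by apply/bigmin_geP; split => // x _; exact: occ_ge0. Qed.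

Lemma min_occ_le_max Z pi : min_occ Z pi <= max_min_occ Z.
Proof.
apply: ub_le_sup; last by exists pi.
by exists 1 => _ [p _ <-]; exact: bigmin_le_id.
Qed.

Lemma min_occ_value {Z} pi {lam} : is_dist Z lam -> min_occ Z pi <= value M pi lam.
Proof.
case=> l0 lZ l1; rewrite -[leLHS]mulr1 -l1 mulr_sumr; apply: ler_sum => x _.
have [xZ|xZ] := boolP (x \in Z); last by rewrite lZ// !mulr0.
by rewrite ler_wpM2r// min_occ_le.
Qed.

(** An average over [Z] is at least the minimum over [Z]. The policy [pi0] keeps the set under the
    supremum nonempty. *)
Lemma max_min_occ_le_opt {Z} pi0 {lam} : is_dist Z lam -> max_min_occ Z <= opt_value M lam.
Proof.
move=> ld; apply: ge_sup; first by exists (min_occ Z pi0); exists pi0.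
move=> _ [pi _ <-]; apply: le_trans (min_occ_value pi ld) _.
apply: ub_le_sup; last by exists pi.
exists 1 => _ [p _ <-]; case: ld => l0 _ <-; apply: ler_sum => x _.
by rewrite ler_piMl// occ_le1.
Qed.

Lemma le_max_min_occ {Z Z'} pi0 : Z' \subset Z -> max_min_occ Z <= max_min_occ Z'.
Proof.
move=> ZZ; apply: ge_sup; first by exists (min_occ Z pi0); exists pi0.
move=> _ [pi _ <-]; apply: le_trans (min_occ_le_max Z' pi).
apply/bigmin_geP; split => [|x xZ]; first exact: bigmin_le_id.
by apply: min_occ_le; move/fintype.subsetP: ZZ; apply.
Qed.

Lemma coverage_ge0 (c : hsa H S A -> R) : (0 <= coverage M c)%E.
Proof.
apply: le_ereal_inf_tmp => _ [pi _ <-].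
exact: bigmax_ge_id.
Qed.

(** If a policy has ratio below [phi + e], its least occupied point [x] of [Z] satisfies
    [b <= c x < (phi + e) * min_occ Z pi]. *)
Lemma le_max_min_occ_coverage {c : hsa H S A -> R} {Z} {x0 : hsa H S A} {b phi} :
  x0 \in Z -> (forall x, x \in Z -> 0 < c x /\ b <= c x) ->
  coverage M c = phi%:E -> b <= max_min_occ Z * phi.
Proof.
move=> x0Z cZ cov.
have phi0 : 0 <= phi by rewrite -lee_fin -cov coverage_ge0.
apply/ler_addgt0Pr => e e0.
have : (coverage M c < (phi + e)%:E)%E by rewrite cov lte_fin ltrDl.
move=> /ereal_inf_lt[_ [pi _ <-]] cpi.
have [x xZ minx] : exists2 x, x \in Z & occ M pi x = min_occ Z pi.
  have [] := @eq_bigmin _ _ _ 1 x0 (fun x => x \in Z) (occ M pi) x0Z.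
    by move=> x _; exact: occ_le1.
  by move=> x xZ minx; exists x.
have [cx0 bcx] := cZ x xZ.
have : ((c x)%:E / (occ M pi x)%:E < (phi + e)%:E)%E.
  by apply: le_lt_trans cpi; apply: (le_bigmax_cond 0%E (fun x => (c x)%:E / (occ M pi x)%:E)%E).
rewrite inver; case: ifPn => [_|occ0]; first by rewrite gt0_muley// lte_fin.
rewrite -EFinM lte_fin ltr_pdivrMr ?lt_neqAle ?[0 == _]eq_sym ?occ0 ?occ_ge0// minx => cphi.
(* This bounds the error [e * min_occ Z pi] by [e]. *)
have v1 : max_min_occ Z <= 1.
  apply: ge_sup; first by exists (min_occ Z pi); exists pi.
  by move=> _ [p _ <-]; exact: bigmin_le_id.
have := min_occ_le_max Z pi; have := min_occ_ge0 Z pi; nra.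
Qed.
End MDP.

(** * Phases of CovGame *)

Section Levels.
Context {R : realType} {H : nat} {S A : finType} (c : hsa H S A -> R).
Implicit Types (s : seq (traj H S A)) (x : hsa H S A).

Lemma cmin_ge1 : 1 <= cmin c.
Proof. by rewrite /cmin le_max lexx orbT. Qed.

Lemma in_supp x : (x \in supp c) = (0 < c x).
Proof. by rewrite inE. Qed.

Lemma in_levelS k x : (x \in level c k.+1) = (cmin c * 2 ^+ k.+1 < c x).
Proof. by rewrite inE. Qed.

Lemma le_cmin_expr j k : (j <= k)%N -> cmin c * 2 ^+ j <= cmin c * 2 ^+ k.
Proof.
move=> jk; rewrite ler_wpM2l ?(le_trans ler01 cmin_ge1)//.
by rewrite ler_weXn2l// ler1n.
Qed.

Lemma level_subset j k : (j <= k)%N -> level c k \subset level c j.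
Proof.
move=> jk; apply/fintype.subsetP => x.
case: k j jk => [|k] [|j]// jk; rewrite in_levelS => xk.
  rewrite /level in_supp; apply: le_lt_trans xk.
  by rewrite mulr_ge0 ?exprn_ge0 ?(le_trans ler01 cmin_ge1).
by rewrite in_levelS; apply: le_lt_trans xk; exact: le_cmin_expr.
Qed.

Lemma level_subset_supp k : level c k \subset supp c.
Proof. exact: (@level_subset 0%N). Qed.

Lemma inf_supp_le x : x \in supp c -> inf [set c x | x in [set x | x \in supp c]] <= c x.
Proof.
move=> xc; apply: ge_inf; last by exists x.
by exists 0 => _ [y yc <-]; rewrite ltW// -in_supp.
Qed.

Lemma le_cmax x : c x <= cmax c.
Proof.
apply: ub_le_sup; last by exists x.
exists (\big[Num.max/c x]_y c y) => _ [y _ <-].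
exact: (le_bigmax_cond (c x) c).
Qed.

Lemma nphases_ge1 : 1 <= nphases c.
Proof. by rewrite /nphases le_max lexx orbT. Qed.

(** For positive [k], a point of the level forces [2 ^ k < cmax c / cmin c]. Hence at most
    [nphases c] phases can occur. *)
Lemma lt_nphases k x : x \in level c k -> k%:Z < nphases c.
Proof.
case: k => [|k]; first by move=> _; apply: lt_le_trans nphases_ge1.
rewrite in_levelS => xk; rewrite /nphases lt_max; apply/orP; left.
have cmin0 : 0 < cmin c := lt_le_trans ltr01 cmin_ge1.
have ln2 : 0 < ln 2 :> R by rewrite ln_gt0// ltr1n.
rewrite -(ltr_int R); apply: lt_le_trans (ceil_ge _).
rewrite ltr_pdivlMr//.
have -> : (Posz k.+1)%:~R * ln 2 = ln (2 ^+ k.+1) :> R by rewrite lnXn// -[RHS]mulr_natl.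
have e2 : (0 : R) < 2 ^+ k.+1 by rewrite exprn_gt0.
rewrite ltr_ln ?posrE// ?divr_gt0// ?ltr_pdivlMr//.
  by rewrite mulrC; exact: lt_le_trans (le_cmax x).
by apply: lt_le_trans (le_cmax x); apply: lt_trans xk; rewrite mulr_gt0.
Qed.

(* A lower bound of [c] on [X_k]. At [k = 0], [cmin c] is not one when some
   positive value of [c] is below 1. *)
Definition level_floor k : R :=
  if k is 0 then inf [set c x | x in [set x | x \in supp c]] else cmin c * 2 ^+ k.

Lemma level_floor_le k x : x \in level c k -> level_floor k <= c x.
Proof.
case: k => [|k]; first exact: inf_supp_le.
by rewrite in_levelS => /ltW.
Qed.

(** The left side will bound the visits to the comparator. The added 2 is for [k = 0], where
    [cmin c] exceeds the infimum by at most 1. *)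
Lemma le_level_floor k x : x \in level c k -> cmin c * 2 ^+ k.+1 <= 2 * level_floor k + 2.
Proof.
case: k => [|k] xk /=; last by rewrite exprS; lra.
set i := inf _; have i0 : 0 <= i.
  apply: lb_le_inf; first by exists (c x); exists x.
  by move=> _ [y yc <-]; rewrite ltW// -in_supp.
by rewrite expr1 /cmin -/i; have [] := leP i 1; lra.
Qed.

Lemma visit_count_rcons s z x :
  visit_count (rcons s z) x = (visit_count s x + visits z x)%N.
Proof. by rewrite /visit_count -cats1 count_cat /= addn0. Qed.

Lemma covered_rcons s z : covered c s -> covered c (rcons s z).
Proof.
move=> cs x; apply: le_trans (cs x) _.
by rewrite visit_count_rcons ler_nat leq_addr.
Qed.

Lemma not_coveredP s : ~ covered c s ->
  exists2 x, x \in supp c & (visit_count s x)%:R < c x.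
Proof.
move=> ns; apply: contrapT => nex; apply: ns => x.
have [xc|xc] := boolP (x \in supp c).
  by rewrite leNgt; apply/negP => xlt; apply: nex; exists x.
by rewrite in_supp -leNgt in xc; apply: le_trans xc _.
Qed.

Definition outside_covered s j : Prop :=
  forall x, x \in supp c :\: level c j -> c x <= (visit_count s x)%:R.

Lemma outside_covered_level s j x : outside_covered s j ->
  x \in supp c -> (visit_count s x)%:R < c x -> x \in level c j.
Proof.
move=> sj xc; apply: contraTT => xj; rewrite -leNgt; apply: sj.
by rewrite inE xj.
Qed.

(** An uncovered point lies in [level c j] for every admissible [j], so [lt_nphases] bounds [j]: the
    maximum exists and [xget] does not return its default. *)
Lemma next_phaseP s : ~ covered c s ->
  outside_covered s (next_phase c s) /\
  forall j, outside_covered s j -> (j <= next_phase c s)%N.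
Proof.
move=> /not_coveredP[x xc xs].
pose Q j := `[< outside_covered s j >].
have Q0 : exists j, Q j.
  by exists 0%N; apply/asboolP => y; rewrite inE; case: (_ \in _).
have Qub j : Q j -> (j <= `|nphases c|)%N.
  move=> /asboolP sj; have := lt_nphases (outside_covered_level sj xc xs).
  by have := nphases_ge1; lia.
have [k /asboolP kQ kmax] := ex_maxnP Q0 Qub.
rewrite /next_phase; case: xgetP => [i -> [iJ imax]|]; first by [].
move=> /(_ k) []; split=> // j jQ; apply: kmax; exact/asboolP.
Qed.

Lemma next_phase_le s s' : ~ covered c s' ->
  (forall x, (visit_count s x <= visit_count s' x)%N) ->
  ~ covered c s -> (next_phase c s <= next_phase c s')%N.
Proof.
move=> ns' ss' ns; apply: (next_phaseP ns').2 => x xs.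
by apply: le_trans ((next_phaseP ns).1 x xs) _; rewrite ler_nat.
Qed.

(** By maximality of the phase, some uncovered point lies outside the next level; it serves as the
    comparator. *)
Lemma next_phase_witness s : ~ covered c s -> exists x,
  [/\ x \in level c (next_phase c s),
      (visit_count s x)%:R <= cmin c * 2 ^+ (next_phase c s).+1
    & (visit_count s x)%:R < c x].
Proof.
move=> ns; have [nJ nmax] := next_phaseP ns.
have : ~ outside_covered s (next_phase c s).+1.
  by move=> /nmax; rewrite ltnn.
move=> /existsNP[x /not_implyP[xs /negP]]; rewrite -ltNge => xlt.
move: xs; rewrite inE => /andP[xl xc]; exists x; split=> //.
  exact: outside_covered_level nJ xc xlt.
by rewrite in_levelS -leNgt in xl; apply: le_trans xl; exact: ltW.
Qed.
End Levels.

(** * The online algorithm during a run *)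

Section Game.
Context {R : realType} {H : nat} {S A : finType} (c : hsa H S A -> R).
Variable Al : online_algo R H S A.
Context {Rl : nat -> R}.
Hypothesis reg : online_regret c Al Rl.
Implicit Types (s : seq (traj H S A)) (x : hsa H S A).
Hypothesis c_supp : supp c != finset.set0.

Lemma is_dist_point (Y : {set hsa H S A}) y : y \in Y ->
  is_dist Y ([ffun x => (x == y)%:R] : vec R H S A).
Proof.
move=> yY; split=> [x|x xY|]; rewrite ?ffunE ?ler0n//.
  by apply/eqP; rewrite pnatr_eq0 eqb0; apply: contraNneq xY => ->.
under eq_bigr do rewrite ffunE -[_%:R]mulr1.
exact: (sum_point y (fun=> 1)).
Qed.

Lemma is_dist_uniform (Y : {set hsa H S A}) : Y != finset.set0 ->
  is_dist Y (uniform Y : vec R H S A).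
Proof.
rewrite -card_gt0 => Y0; split=> [x|x /negPf xY|]; rewrite ?ffunE.
- by rewrite divr_ge0.
- by rewrite xY mul0r.
- under eq_bigr do rewrite ffunE.
  rewrite -mulr_suml -natr_sum -[X in X%:R](_ : #|Y| = _).
    by rewrite divff// pnatr_eq0 -lt0n.
  by rewrite -sum1_card big_mkcond.
Qed.

Lemma is_distS (Y Z : {set hsa H S A}) (lam : vec R H S A) :
  Y \subset Z -> is_dist Y lam -> is_dist Z lam.
Proof.
move=> /fintype.subsetP YZ [l0 lY l1]; split=> // x xZ; apply: lY.
by apply: contra xZ; exact: YZ.
Qed.

Lemma loss_val_cg_loss k (w : traj H S A) lam : is_dist (level c k) lam ->
  loss_val (cg_loss c k w) lam = gain lam w.
Proof.
move=> [_ lY _]; apply: eq_bigr => x _; rewrite ffunE.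
by have [//|xk] := boolP (x \in level c k); rewrite lY// !mul0r.
Qed.

Lemma online_regret_phase k (l : nat -> traj H S A) : level c k != finset.set0 ->
  let lam t := Al (level c k) (mkseq (fun i => cg_loss c k (l i)) t) in
  (forall t, is_dist (level c k) (lam t)) /\
  forall n, (0 < n)%N ->
    let L := \sum_(t < n) gain (lam t) (l t) in
    L - inf [set \sum_(t < n) gain mu (l t) | mu in is_dist (level c k)]
      <= Num.sqrt (Rl n * L) + Rl n.
Proof.
move=> Yk; have := @reg k (fun i => cg_loss c k (l i)) Yk.
case=> [t x xY|t mu mud|lamd regn]; first by rewrite ffunE (negPf xY).
  by rewrite loss_val_cg_loss// (gain_ge0 _ mud) (gain_le1 _ mud).
split=> // n n0 /=; have /= := regn n n0.
under eq_bigr => i _ do rewrite (loss_val_cg_loss _ (lamd i)).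
congr (_ - inf _ <= _); apply: eq_imagel => mu mud.
by apply: eq_bigr => i _; rewrite loss_val_cg_loss.
Qed.

(** Zero losses make both the regret and the square root vanish. *)
Lemma Rl_ge0 n : (0 < n)%N -> 0 <= Rl n.
Proof.
move=> n0; have [|t mu _|_ /(_ n n0)] := @reg 0%N (fun=> [ffun=> 0]) c_supp.
- by move=> t x _; rewrite ffunE.
- by rewrite /loss_val big1 ?lexx ?ler01// => x _; rewrite ffunE mulr0.
rewrite /= big1 => [|i _]; last by rewrite /loss_val big1// => x _; rewrite ffunE mulr0.
rewrite mulr0 sqrtr0 !add0r (_ : [set _ | _ in _] = [set 0]%classic) ?inf1 ?oppr0//.
apply/seteqP; split=> [_ [mu _ <-]|_ ->] /=.
  by rewrite big1// => i _; rewrite /loss_val big1// => x _; rewrite ffunE mulr0.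
exists (uniform (supp c)); first exact: is_dist_uniform.
by rewrite big1// => i _; rewrite /loss_val big1// => x _; rewrite !ffunE mulr0.
Qed.

(** The point mass at [y] has as total loss the number [v] of visits to [y], and
    [L - v <= sqrt (Rl n * L) + Rl n] becomes [L <= 2 v + 3 Rl n] by AM-GM. *)
Lemma phase_gain_le k (l : nat -> traj H S A) n y : (0 < n)%N -> y \in level c k ->
  \sum_(t < n) gain (Al (level c k) (mkseq (fun i => cg_loss c k (l i)) t)) (l t)
    <= 2 * (\sum_(t < n) visits (l t) y)%:R + 3 * Rl n.
Proof.
move=> n0 yk; have Yk : level c k != finset.set0 by apply/finset.set0Pn; exists y.
have [lamd /(_ n n0) /=] := online_regret_phase l Yk.
set L := \sum_(t < n) _; set I := inf _ => regn.
have L0 : 0 <= L by apply: sumr_ge0 => t _; exact: gain_ge0 (lamd t).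
have IN : I <= (\sum_(t < n) visits (l t) y)%:R.
  apply: ge_inf.
    exists 0 => _ [mu mud <-]; apply: sumr_ge0 => t _; exact: gain_ge0 mud.
  exists [ffun x => (x == y)%:R]; first exact: is_dist_point.
  rewrite natr_sum; apply: eq_bigr => t _; rewrite /gain.
  under eq_bigr do rewrite ffunE.
  exact: (sum_point y (fun x => (visits (l t) x)%:R)).
have := sqrtr_mul_le (Rl_ge0 n0) L0; lra.
Qed.

Definition cg_run s := foldl (cg_step c Al) (cg_init c) s.

Lemma cg_run_rcons s z : cg_run (rcons s z) = cg_step c Al (cg_run s) z.
Proof. by rewrite /cg_run -cats1 foldl_cat. Qed.

Lemma cg_hist_run s : cg_hist (cg_run s) = s.
Proof.
elim/last_ind: s => [//|s z IHs]; rewrite cg_run_rcons -[in RHS]IHs.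
by case: (cg_run s) => h k ls lam /=; case: ifP => // _; case: ifP.
Qed.

(** The losses are recorded as coming from trajectories because this makes them admissible in
    [online_regret], so that the next output is a distribution. *)
Lemma cg_run_inv s (st := cg_run s) :
  [/\ level c (cg_phase st) != finset.set0, is_dist (level c (cg_phase st)) (cg_lam st)
    & exists ws, cg_losses st = map (cg_loss c (cg_phase st)) ws].
Proof.
rewrite {}/st; elim/last_ind: s => [|s z].
  split=> //; [exact: is_dist_uniform|by exists [::]].
rewrite cg_run_rcons; have := cg_hist_run s.
case: (cg_run s) => h k ls lam /= -> [Yk lamd [ws lsE]].
case: asboolP => [_|ns]; first by split=> //; exists ws.
case: ifP => _ /=.
  have [x [xl _ _]] := next_phase_witness ns.
  have Yn : level c (next_phase c (rcons s z)) != finset.set0 by apply/finset.set0Pn; exists x.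
  split=> //; [exact: is_dist_uniform|by exists [::]].
have lsE' : rcons ls (cg_loss c k z) = map (cg_loss c k) (rcons ws z).
  by rewrite map_rcons lsE.
split=> //; last by exists (rcons ws z).
(* The list is read as a prefix of an infinite sequence, as [online_regret] expects; the padding is
   never seen by [Al]. *)
rewrite lsE' -{1}(mkseq_nth z (rcons ws z)) -map_comp.
exact: (online_regret_phase (nth z (rcons ws z)) Yk).1 (size (rcons ws z)).
Qed.

Lemma covgame_dist s : is_dist (supp c) (covgame c Al s).
Proof.
have [_ lamd _] := cg_run_inv s.
exact: is_distS (level_subset_supp c (cg_phase (cg_run s))) lamd.
Qed.

Lemma visit_count_mkseq (z : nat -> traj H S A) n x :
  visit_count (mkseq z n) x = (\sum_(t < n) visits (z t) x)%N.
Proof.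
elim: n => [|n IHn]; first by rewrite big_ord0.
by rewrite mkseqS visit_count_rcons IHn big_ord_recr.
Qed.

(** * Phases along a run that has not covered the target *)

Section Path.
Variable z : nat -> traj H S A.
Context {N : nat}.
Hypothesis unc : ~ covered c (mkseq z N).

Let st n := cg_run (mkseq z n).
Let k n := cg_phase (st n).
Let lam n := covgame c Al (mkseq z n).

(** Index [n] stands for episode [n + 1], and [k n] is the phase in which it is played. *)
Definition phase_start n : bool := (n == 0)%N || (k n != k n.-1).

Lemma uncovered_le n : (n <= N)%N -> ~ covered c (mkseq z n).
Proof.
move=> nN cov; apply: unc; rewrite -(subnKC nN).
elim: (N - n)%N => [|m IHm]; first by rewrite addn0.
by rewrite addnS mkseqS; exact: covered_rcons.
Qed.

Lemma phaseS n : (n < N)%N -> k n.+1 = next_phase c (mkseq z n.+1).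
Proof.
move=> nN; rewrite /k /st mkseqS cg_run_rcons -mkseqS; have := cg_hist_run (mkseq z n).
case: (cg_run _) => h k' ls l /= ->; rewrite -mkseqS.
case: asboolP => [/uncovered_le|_]; first by move/(_ nN).
by case: eqP.
Qed.

Lemma phase_leS n : (n < N)%N -> (k n <= k n.+1)%N.
Proof.
case: n => // n nN; rewrite (phaseS (ltnW nN)) phaseS//.
apply: next_phase_le; [exact: uncovered_le| |exact/uncovered_le/ltnW].
by move=> x; rewrite [mkseq z n.+2]mkseqS visit_count_rcons leq_addr.
Qed.

(** [s] is the start of the current phase and [j] the number of losses fed since then. The reward at
    offset 0 is not an output of [Al], hence the restriction to [0 < i]. *)
Lemma phase_run n : (n <= N)%N -> exists s j : nat,
  let l i := cg_loss c (k n) (z (s + i)) in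
  [/\ n = (s + j)%N, phase_start s, forall i, (i <= j)%N -> k (s + i) = k n,
      cg_losses (st n) = mkseq l j
    & forall i, (0 < i <= j)%N -> lam (s + i) = Al (level c (k n)) (mkseq l i)].
Proof.
elim: n => [_|n IHn nN].
  by exists 0%N, 0%N; split=> // [i|i]; [rewrite leqn0 => /eqP ->|case: i].
have [s [j [nE s0 kE lsE lamE]]] := IHn (ltnW nN).
have [kS|kS] := eqVneq (k n.+1) (k n); last first.
  exists n.+1, 0%N; split=> //; rewrite ?addn0//.
  - by move=> i; rewrite leqn0 => /eqP ->; rewrite addn0.
  - move: kS; rewrite phaseS// /st mkseqS cg_run_rcons /k /st.
    have := cg_hist_run (mkseq z n).
    case: (cg_run _) => h k' ls l /= ->; rewrite -mkseqS => kS.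
    case: asboolP => [/uncovered_le|_]; first by move/(_ nN).
    by rewrite kS.
  - by case.
have [lsS lamS] : cg_losses (st n.+1) = mkseq (fun i => cg_loss c (k n) (z (s + i))) j.+1 /\
    lam n.+1 = Al (level c (k n)) (mkseq (fun i => cg_loss c (k n) (z (s + i))) j.+1).
  move: kS lsE; rewrite phaseS// /lam /covgame -/(cg_run _) /st mkseqS cg_run_rcons /k /st.
  have := cg_hist_run (mkseq z n).
  case: (cg_run _) => h k' ls l /= ->; rewrite -mkseqS => kS lsE.
  case: asboolP => [/uncovered_le|_]; first by move/(_ nN).
  by rewrite kS eqxx/= mkseqS lsE -nE.
exists s, j.+1; split; rewrite ?kS//; first by rewrite addnS nE.
  move=> i; rewrite leq_eqVlt => /predU1P[->|]; last exact: kE.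
  by rewrite addnS -nE.
move=> i /andP[i0]; rewrite leq_eqVlt => /predU1P[->|ij]; first by rewrite addnS -nE.
by apply: lamE; rewrite i0.
Qed.

(* [2 (2 level_floor + 2) + 3 Rl N] bounds the gain of the online algorithm on the
   losses it is fed; 2 more account for the first episode of the phase, played
   with the uniform reward, and for the last one, which is not fed to it. *)
Definition phase_budget i : R := 4 * level_floor c i + 6 + 3 * Rl N.

Lemma level_phase n : exists x, x \in level c (k n).
Proof. by have [/finset.set0Pn] := cg_run_inv (mkseq z n). Qed.

Lemma covgame_gain_le1 n : gain (lam n) (z n) <= 1.
Proof. exact: gain_le1 (covgame_dist _). Qed.

Lemma phase_budget_ge0 n : (0 < N)%N -> 0 <= phase_budget (k n).
Proof.
move=> /Rl_ge0; have [x /le_level_floor] := level_phase n.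
have : 0 <= cmin c * 2 ^+ (k n).+1.
  by rewrite mulr_ge0 ?exprn_ge0 ?(le_trans ler01 (cmin_ge1 c)).
rewrite /phase_budget; move: (cmin c * _) (level_floor _ _) (Rl N) => a b r; lra.
Qed.

Hypothesis Rl_mono : {homo Rl : n m / (n <= m)%N >-> n <= m}.

(** The comparator is chosen from the history before the last episode, which determines the phase
    [k (s + j)]. The last gain is therefore bounded by 1 separately. *)
Lemma phase_gain_sum_le (s j : nat) : (s + j < N)%N ->
  (forall i, (0 < i <= j)%N -> lam (s + i) = Al (level c (k (s + j)))
     (mkseq (fun i => cg_loss c (k (s + j)) (z (s + i))) i)) ->
  \sum_(i < j.+1) gain (lam (s + i)) (z (s + i)) <= phase_budget (k (s + j)).
Proof.
move=> jN lamE; have N0 : (0 < N)%N by exact: leq_ltn_trans jN.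
rewrite big_ord_recr/=; have := covgame_gain_le1 (s + j).
case: j jN lamE => [|j] jN lamE.
  rewrite big_ord0; have [x /le_level_floor] := level_phase (s + 0).
  have : 0 <= cmin c * 2 ^+ (k (s + 0)).+1.
    by rewrite mulr_ge0 ?exprn_ge0 ?(le_trans ler01 (cmin_ge1 c)).
  have := Rl_ge0 N0; rewrite /phase_budget.
  move: (cmin c * _) (level_floor _ _) (Rl N) (gain _ _) => a b r g; lra.
have [y []] := next_phase_witness (uncovered_le (ltnW jN)).
have <- : k (s + j.+1) = next_phase c (mkseq z (s + j.+1)).
  by rewrite addnS phaseS// -addnS ltnW.
move=> yk ycount _.
have := phase_gain_le (fun i => z (s + i)) (ltn0Sn j) yk.
(* The reward at offset 0 need not be the first output of [Al]; its gain is at most 1. *)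
have : \sum_(i < j.+1) gain (lam (s + i)) (z (s + i)) <=
    \sum_(i < j.+1) (gain (Al (level c (k (s + j.+1)))
      (mkseq (fun i => cg_loss c (k (s + j.+1)) (z (s + i))) i)) (z (s + i))
      + (i == 0 :> nat)%:R).
  apply: ler_sum => -[[|i] ij] _ /=; last by rewrite addr0 lamE// (ltnW ij).
  rewrite (le_trans (covgame_gain_le1 _))// lerDr.
  apply: (@gain_ge0 _ _ _ _ (level c (k (s + j.+1)))).
  by apply: (online_regret_phase (fun i => z (s + i)) _).1 0%N; apply/finset.set0Pn; exists y.
rewrite big_split/= [X in _ <= _ + X]big_ord_recl/= [X in _ <= _ + (_ + X)]big1// addr0.
have : (\sum_(i < j.+1) visits (z (s + i)) y)%:R <= cmin c * 2 ^+ (k (s + j.+1)).+1.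
  apply: le_trans ycount; rewrite ler_nat visit_count_mkseq big_split_ord/=.
  exact: leq_addl.
have := le_level_floor yk; rewrite /phase_budget.
have : Rl j.+1 <= Rl N by apply: Rl_mono; apply: leq_trans (ltnW jN); exact: leq_addl.
move: (\sum_(i < _) gain _ _) (\sum_(i < _) gain _ _) (gain _ _) (Rl _) (Rl _).
move: (\sum_(i < _) _)%:R (cmin c * _) (level_floor _ _) => v a b; clear ycount => *; lra.
Qed.

(** Strong induction: [phase_run] cuts off the last phase, whose budget is charged to its first
    episode. *)
Lemma gain_sum_le n : (n <= N)%N ->
  \sum_(t < n) gain (lam t) (z t) <= \sum_(t < n) (phase_start t)%:R * phase_budget (k t).
Proof.
have [n' nn'] := ubnP n; elim: n' n nn' => // n' IHn [_ _|n nn' nN]; first by rewrite !big_ord0.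
have [s [j [nE s0 kE _ lamE]]] := phase_run (ltnW nN).
have N0 : (0 < N)%N by exact: leq_ltn_trans nN.
subst n; rewrite -addnS !big_split_ord/= lerD//.
  by apply: IHn; lia.
apply: le_trans (phase_gain_sum_le nN lamE) _.
have <- : k s = k (s + j) by rewrite -(kE 0%N)// addn0.
rewrite big_ord_recl/= addn0 s0 mul1r lerDl.
by apply: sumr_ge0 => i _; rewrite mulr_ge0 ?phase_budget_ge0.
Qed.

(** Phases never decrease, so each start after the first raises the phase by at least 1; some phases
    may be skipped. *)
Lemma phase_start_count n : (n <= N)%N -> (\sum_(t < n.+1) phase_start t <= (k n).+1)%N.
Proof.
elim: n => [_|n IHn nN]; first by rewrite big_ord_recr big_ord0.
rewrite big_ord_recr/=; have := IHn (ltnW nN); have := phase_leS nN.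
by rewrite {3}/phase_start/=; case: eqVneq => /=; lia.
Qed.

Lemma phase_start_count_nphases : (0 < N)%N ->
  \sum_(t < N) (phase_start t)%:R <= (nphases c)%:~R :> R.
Proof.
move=> N0; rewrite -natr_sum -(prednK N0).
have [x /lt_nphases kn] := level_phase N.-1.
have := phase_start_count (leq_pred N).
rewrite -lez_nat => cnt; rewrite -[_%:R]/((Posz _)%:~R) ler_int.
by apply: le_trans cnt _; rewrite intS addrC lezD1.
Qed.
End Path.
End Game.

(** * The number of episodes on the good event *)

Section Bound.
Context {R : realType} {H : nat} {S A : finType} {M : mdp R H S A}.
Context {c : hsa H S A -> R} {delta : R} {Al : online_algo R H S A} {Rl RP : nat -> R}.
Hypothesis c_supp : supp c != finset.set0.
Hypothesis delta01 : 0 < delta < 1.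
Hypothesis Rl_mono : {homo Rl : n m / (n <= m)%N >-> n <= m}.
Hypothesis RP_mono : {homo RP : n m / (n <= m)%N >-> n <= m}.
Hypothesis reg : online_regret c Al Rl.

Let L n : R := ln (4 * n%:R / delta).

Lemma log_term_ge1 n : (0 < n)%N -> 1 <= L n.
Proof.
move=> n0; apply: le_trans (@ln4_ge1 R) _; rewrite ler_ln ?posrE//.
  rewrite -mulrA ler_pMr// ler_pdivlMr ?(andP delta01).1// mul1r.
  by rewrite (le_trans (ltW (andP delta01).2))// ler1n.
by rewrite divr_gt0 ?mulr_gt0 ?ltr0n ?(andP delta01).1.
Qed.

Lemma le_log_term n m : (0 < n <= m)%N -> L n <= L m.
Proof.
move=> /andP[n0 nm]; rewrite ler_ln ?posrE ?divr_gt0 ?mulr_gt0 ?ltr0n ?(andP delta01).1//.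
  by rewrite ler_pM2r ?invr_gt0 ?(andP delta01).1// ler_pM2l// ler_nat.
exact: leq_trans nm.
Qed.

(** * A fixed path satisfying both random bounds *)

Variables (z : nat -> traj H S A) (pi : nat -> policy R H S A).
Let lam t := covgame c Al (mkseq z t).
Let V n := \sum_(t < n) value M (pi t) (lam t).

Hypothesis rl_regret_path : forall n, (0 < n)%N ->
  \sum_(t < n) opt_value M (lam t) - V n <= Num.sqrt (RP n * V n) + RP n.
Hypothesis gain_deviation : forall n, (0 < n)%N ->
  V n <= 2 * \sum_(t < n) gain (lam t) (z t) + 4 * L n.

Let lam_dist t : is_dist (supp c) (lam t) := covgame_dist reg c_supp _.

Lemma value_sum_ge0 n : 0 <= V n.
Proof. by apply: sumr_ge0 => t _; apply: value_ge0; case: (lam_dist t). Qed.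

(** A negative [RP n] would make the square root 0 and the regret negative, but no policy beats the
    optimum. *)
Lemma RP_ge0 n : (0 < n)%N -> 0 <= RP n.
Proof.
move=> n0; rewrite leNgt; apply/negP => RPn0.
have := rl_regret_path n0; rewrite ler0_sqrtr; last first.
  by rewrite mulr_le0_ge0 ?value_sum_ge0// ltW.
rewrite add0r leNgt => /negP; apply; apply: lt_le_trans RPn0 _.
rewrite subr_ge0; apply: ler_sum => t _; exact: value_le_opt (lam_dist t).
Qed.

(** AM-GM bounds the optimal values by [3 / 2 * (V n + RP n)], and [gain_deviation] replaces
    [V n]. *)
Lemma opt_sum_le n : (0 < n)%N -> \sum_(t < n) opt_value M (lam t) <=
  3 * \sum_(t < n) gain (lam t) (z t) + 6 * L n + 3 / 2 * RP n.
Proof.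
move=> n0; have := rl_regret_path n0; have := gain_deviation n0.
have := sqrtr_mul_le (RP_ge0 n0) (value_sum_ge0 n).
move: (\sum_(t < _) _) (\sum_(t < _) _) (V n) (L n) (RP n) (Num.sqrt _) => *; lra.
Qed.

Context {N : nat} {phi : R}.
Hypothesis N_gt0 : (0 < N)%N.
Hypothesis unc : ~ covered c (mkseq z N).
Hypothesis coverage_phi : coverage M c = phi%:E.
Hypothesis T1_condN : T1_cond M c delta Rl RP N.

Let k n := cg_phase (cg_run c Al (mkseq z n)).
Let v n := max_min_occ M (level c (k n)).
Let m : R := (nphases c)%:~R.
(** The factor 3 of [opt_sum_le] times [m * (6 + 3 * Rl N)], the part of the phase budgets free of
    [level_floor], plus the other terms of [opt_sum_le]. *)
Let D : R := m * (18 + 9 * Rl N) + 6 * L N + 3 / 2 * RP N.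
Let st n : R := (phase_start c Al z n)%:R.

Lemma level_floor_le_phase_value n : level_floor c (k n) <= v n * phi.
Proof.
have [x xk] := level_phase reg c_supp z n.
apply: (le_max_min_occ_coverage xk _ coverage_phi) => y yk.
split; last exact: level_floor_le.
by rewrite -in_supp (fintype.subsetP (level_subset_supp _ _) _ yk).
Qed.

Lemma phase_value_le_opt n : v n <= opt_value M (lam n).
Proof.
have [_ lamd _] := cg_run_inv reg c_supp (mkseq z n).
exact: (max_min_occ_le_opt M (pi 0%N) lamd).
Qed.

Lemma phase_value_leS n : (n < N)%N -> v n <= v n.+1.
Proof.
move=> nN; apply: (le_max_min_occ M (pi 0%N)); apply: level_subset.
exact: (phase_leS Al unc nN).
Qed.

Lemma nphasesR_ge1 : 1 <= m.
Proof. by rewrite /m -[1]/(1%:~R) ler_int nphases_ge1. Qed.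

Lemma phase_start_sum_le n : (n <= N)%N -> \sum_(t < n) st t <= m.
Proof.
move=> nN; apply: le_trans (phase_start_count_nphases reg c_supp unc N_gt0).
rewrite -(big_mkord xpredT st) -(big_mkord xpredT st) (big_cat_nat _ nN)//= lerDl.
exact: sumr_ge0.
Qed.

(** The 12 is the factor 3 of [opt_sum_le] times the factor 4 of [phase_budget], with [level_floor]
    replaced by [v t * phi]. *)
Lemma weighted_sum_le n : (n <= N)%N ->
  \sum_(t < n) (1 - 12 * phi * st t) * v t <= D.
Proof.
have R0 := Rl_ge0 reg c_supp N_gt0; have RP0 := RP_ge0 N_gt0.
have L1 := log_term_ge1 N_gt0; have m1 := nphasesR_ge1.
case: n => [|n] nN.
  rewrite big_ord0 /D; move: (Rl N) (RP N) (L N) m R0 RP0 L1 m1 => a b d e *; nra.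
have -> : \sum_(t < n.+1) (1 - 12 * phi * st t) * v t =
    \sum_(t < n.+1) v t - \sum_(t < n.+1) st t * (12 * (v t * phi)).
  by rewrite -sumrB; apply: eq_bigr => t _; ring.
have vG : \sum_(t < n.+1) v t <= \sum_(t < n.+1) opt_value M (lam t).
  by apply: ler_sum => t _; exact: phase_value_le_opt.
have yB : \sum_(t < n.+1) gain (lam t) (z t) <=
    \sum_(t < n.+1) st t * (4 * (v t * phi)) + m * (6 + 3 * Rl N).
  apply: le_trans (gain_sum_le reg c_supp unc Rl_mono nN) _.
  apply: (@le_trans _ _ (\sum_(t < n.+1) (st t * (4 * (v t * phi)) + st t * (6 + 3 * Rl N)))).
    apply: ler_sum => t _; rewrite -mulrDr ler_wpM2l// /phase_budget.
    have := level_floor_le_phase_value t; rewrite /k.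
    move: (level_floor _ _) (v _ * _) (Rl N) => *; lra.
  rewrite big_split/= lerD2l -mulr_suml ler_wpM2r ?phase_start_sum_le//.
  by move: (Rl N) R0 => *; lra.
have e : \sum_(t < n.+1) st t * (12 * (v t * phi)) = 3 * \sum_(t < n.+1) st t * (4 * (v t * phi)).
  by rewrite mulr_sumr; apply: eq_bigr => t _; ring.
have := opt_sum_le (ltn0Sn n); have : L n.+1 <= L N by rewrite le_log_term.
have := RP_mono nN; rewrite e /D.
move: (\sum_(t < _) st _ * _) (\sum_(t < _) v _) (\sum_(t < _) opt_value _ _)
  (\sum_(t < _) gain _ _) (L _) (L _) (RP _) (RP _) (Rl N) m vG yB {R0 RP0 L1 m1 e} => *; lra.
Qed.

(** Removing the weights gives [N <= 12 * phi * m + D / v 0], where the last term is at most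
    [N / 2 - 1]; then solve for [N]. *)
Lemma uncovered_episode_bound : N%:R <= 24 * phi * m - 2.
Proof.
have R0 := Rl_ge0 reg c_supp N_gt0; have RP0 := RP_ge0 N_gt0.
have L1 := log_term_ge1 N_gt0; have m1 := nphasesR_ge1.
have [x xs] := finset.set0Pn _ c_supp.
have := T1_condN; rewrite /T1_cond -/(L N) -/m.
set E := 3 * RP N + 12 * Rl N + 24 * L N.
have E0 : 0 < E by rewrite /E; move: (Rl N) (RP N) (L N) R0 RP0 L1 => *; lra.
(* An infinite coverage would make the left side of [T1_cond] infinite, as [m] and [E] are
   positive. *)
case covE : (coverage M (supp_ind c)) => [phi1| |]; first last.
- by have := coverage_ge0 M (supp_ind c); rewrite covE.
- by rewrite gt0_muley ?lte_fin ?(lt_le_trans ltr01)// gt0_mulye ?lte_fin.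
rewrite -!EFinM -EFinD lee_fin => T1N.
have phi1_ge0 : 0 <= phi1 by rewrite -lee_fin -covE coverage_ge0.
(* The initial level is [supp c], where the indicator equals 1. *)
have v01 : 1 <= v 0%N * phi1.
  apply: (le_max_min_occ_coverage (x0 := x) xs _ covE) => y ys.
  by rewrite /supp_ind ys.
have v0 : 0 < v 0%N.
  rewrite ltNge; apply/negP => v0.
  by move: (v 0%N) v01 v0 => *; nra.
have D0 : 0 <= D.
  by rewrite /D; move: (Rl N) (RP N) (L N) m R0 RP0 L1 m1 => a b d e *; nra.
have vmono i : (i.+1 < N)%N -> v i <= v i.+1 by move=> iN; rewrite phase_value_leS// ltnW.
have := @sum_le_of_weighted _ v (fun t => 1 - 12 * phi * st t) D N D0 v0 vmono weighted_sum_le.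
rewrite sumrB -mulr_sumr sumr_const card_ord -mulr_natr mul1r.
have phi0 : 0 <= phi by rewrite -lee_fin -coverage_phi coverage_ge0.
have := phase_start_sum_le (leqnn N).
have : D / v 0%N <= D * phi1.
  by rewrite ler_wpM2l// -[leLHS]mul1r ler_pdivrMr// mulrC.
(* Since [m] and [L N] are at least 1, [18 * m + 6 * L N <= 24 * m * L N]. *)
have DE : D <= m * E.
  by rewrite /D /E; move: (Rl N) (RP N) (L N) m R0 RP0 L1 m1 => a b d e *; nra.
have : D * phi1 <= m * E * phi1 by rewrite ler_wpM2r.
move: T1N; rewrite mulrAC.
move: (\sum_(t < _) _) (N%:R) (D / _) (D * phi1) (m * E * phi1) => s n d d' e.
move: m m1 => m' m1 *.
have : phi * s <= phi * m' by rewrite ler_wpM2l.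
lra.
Qed.
End Bound.

(** * Deviation of the collected rewards *)

(* One step of the supermartingale [exp (sum_t (V_t / 2 - y_t))]. *)
Lemma sum_exp_gain_le1 (R : realType) (H : nat) (S A : finType) (M : mdp R H S A)
    (pi : policy R H S A) Y (lam : vec R H S A) (x0 : S * A) :
  is_dist Y lam ->
  \sum_w traj_prob M pi w * expR (value M pi lam / 2 - gain lam w) <= 1.
Proof.
move=> ld; set v := value M pi lam.
apply: (@le_trans _ _ (expR (v / 2) * (1 - v / 2))); last first.
  apply: (@le_trans _ _ (expR (v / 2) * expR (- (v / 2)))).
    by rewrite ler_pM2l ?expR_gt0// expR_ge1Dx.
  by rewrite -expRD subrr expR0.
apply: (@le_trans _ _ (expR (v / 2) *
    (\sum_w traj_prob M pi w - (\sum_w traj_prob M pi w * gain lam w) / 2))).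
  rewrite mulr_suml -sumrB mulr_sumr; apply: ler_sum => w _.
  rewrite expRD -mulrA mulrCA ler_pM2l ?expR_gt0//.
  rewrite -[X in _ <= X - _]mulr1 -mulrBr ler_wpM2l ?traj_prob_ge0//.
  by rewrite expRN_le_half// (gain_ge0 _ ld) (gain_le1 _ ld).
by rewrite -value_gain ler_pM2l ?expR_gt0// lerD2r sum_traj_prob_le1.
Qed.
Section Deviation.
Context {R : realType} {H : nat} {S A : finType}.
Context {dU : measure_display} {U : measurableType dU}.
Context {M : mdp R H S A} {nu : probability U R} {AP : rl_algo R H S A U} {eps : R}.
Variable rew : seq (traj H S A) -> vec R H S A.
Context {Y : {set hsa H S A}}.
Hypothesis rew_dist : forall s, is_dist Y (rew s).
Hypothesis AP_meas : measurable_rl_algo AP.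

Local Notation X := (traj H S A).
Let pl u (w : nat -> X) i := played AP eps rew u w i.
Let reward (w : nat -> X) i := rew (mkseq w i).
Let excess u w i : R := value M (pl u w i) (reward w i) / 2 - gain (reward w i) (w i).
Let like u w i : R := traj_prob M (pl u w i) (w i).

Lemma measurable_traj_prob (past : seq (vec R H S A * X)) lam z :
  measurable_fun [set: U] (fun u => traj_prob M (AP eps u past lam) z).
Proof.
by apply: measurable_prod => h _; apply: measurable_funM.
Qed.

Lemma measurable_value (past : seq (vec R H S A * X)) lam lam' :
  measurable_fun [set: U] (fun u => value M (AP eps u past lam) lam').
Proof.
apply: measurable_sum => x; apply: measurable_funM => //.
rewrite /occ; under eq_fun do rewrite big_mkcond/=.
apply: measurable_sum => z; case: (visits z x) => //.
exact: measurable_traj_prob.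
Qed.

Lemma measurable_excess w n : measurable_fun [set: U] (fun u => \sum_(i < n) excess u w i).
Proof.
apply: measurable_sum => i; apply: measurable_funB => //.
by apply: measurable_funM => //; exact: measurable_value.
Qed.

Lemma measurable_like w n : measurable_fun [set: U] (fun u => \prod_(i < n) like u w i).
Proof. by apply: measurable_prod => i _; exact: measurable_traj_prob. Qed.

Lemma like_ge0 u w n : 0 <= \prod_(i < n) like u w i.
Proof. by apply: prodr_ge0 => i _; exact: traj_prob_ge0. Qed.

(** For a fixed seed this is the mean of the exponential. The policy and reward of an episode depend
    only on earlier trajectories, so the factors are adapted. *)
Lemma sum_like_excess_le1 (x0 : S * A) u (w0 : X) n :
  \sum_(t : n.-tuple X) (\prod_(i < n) like u (nth w0 t) i) *
     expR (\sum_(i < n) excess u (nth w0 t) i) <= 1.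
Proof.
under eq_bigr do rewrite expR_sum -big_split/=.
have mkseqE i w w' : (forall j, (j < i)%N -> w j = w' j) -> mkseq w i = mkseq w' i :> seq X.
  by move=> ww; apply/eq_in_map => j; rewrite mem_iota => /ww.
have plE i w w' : (forall j, (j < i)%N -> w j = w' j) -> pl u w i = pl u w' i.
  move=> ww; rewrite /pl /played (mkseqE _ _ _ ww); congr (AP _ _ _ _).
  apply/eq_in_map => j; rewrite mem_iota/= add0n => ji; rewrite ww//.
  by rewrite (mkseqE _ w w')// => l lj; apply: ww; exact: ltn_trans ji.
apply: (@sum_prod_adapted_le1 _ _ w0 (fun i w => like u w i * expR (excess u w i))).
- move=> i w w' ww; have ww' j : (j < i)%N -> w j = w' j by move=> /ltnW /ww.
  by rewrite /like /excess /reward (plE _ _ _ ww') (mkseqE _ _ _ ww') ww.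
- by move=> i w; rewrite mulr_ge0 ?expR_ge0 ?traj_prob_ge0.
- move=> i w; rewrite (eq_bigr (fun x => traj_prob M (pl u w i) x *
      expR (value M (pl u w i) (reward w i) / 2 - gain (reward w i) x))).
    exact: sum_exp_gain_le1 (rew_dist _).
  move=> x _; have ww j : (j < i)%N -> (if j == i then x else w j) = w j by case: ltngtP.
  by rewrite /like /excess /reward (plE _ _ _ ww) (mkseqE _ _ _ ww) eqxx.
Qed.

Context {d : measure_display} {T : measurableType d} {P : probability T R}.
Context {xi : T -> U} {z : nat -> T -> X}.
Hypothesis run : is_run M nu AP eps rew P xi z.

Let dev n (a : R) : set T := [set o | a <= \sum_(i < n) excess (xi o) (z^~ o) i].

(** [is_run] gives the law on cylinders, so the event is split by the first [n] trajectories; [w0]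
    is only a default for [nth]. *)
Lemma devE n (a : R) (w0 : X) : dev n a = \big[setU/set0]_(t : n.-tuple X)
  (xi @^-1` [set u | a <= \sum_(i < n) excess u (nth w0 t) i] `&`
   [set o | forall i, (i < n)%N -> z i o = nth w0 t i]).
Proof.
have excE u w w' : (forall j, (j < n)%N -> w j = w' j) ->
    \sum_(i < n) excess u w i = \sum_(i < n) excess u w' i.
  move=> ww; apply: eq_bigr => i _; have mkseqE j : (j <= n)%N -> mkseq w j = mkseq w' j.
    by move=> jn; apply/eq_in_map => l; rewrite mem_iota => lj; apply: ww; exact: leq_trans jn.
  rewrite /excess /reward /pl /played (mkseqE i (ltnW (ltn_ord i))) ww//.
  congr (value _ (AP _ _ _ _) _ / 2 - _).
  apply/eq_in_map => j; rewrite mem_iota/= add0n => ji.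
  by rewrite mkseqE ?ww// ?(ltn_trans ji)// ltnW// (ltn_trans ji).
rewrite -bigcup_seq; apply/seteqP; split=> om; last first.
  by move=> [t _ [+ zt]]; rewrite /dev /= (excE _ (z^~ om) (nth w0 t)).
move=> devo.
have ztE i : (i < n)%N -> z i om = nth w0 (mktuple (fun j : 'I_n => z j om)) i.
  by move=> iN; rewrite (nth_mktuple _ _ (Ordinal iN)).
exists (mktuple (fun j : 'I_n => z j om)); first by rewrite /= mem_index_enum.
by split=> //=; rewrite -(excE _ (z^~ om)).
Qed.

Lemma measurable_dev_word n (a : R) (w : nat -> X) :
  measurable [set u | a <= \sum_(i < n) excess u w i].
Proof.
by rewrite -[X in measurable X]setTI; apply: measurable_fun_le => //; exact: measurable_excess.
Qed.

Lemma measurable_dev_cylinder n (a : R) (w : nat -> X) :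
  measurable (xi @^-1` [set u | a <= \sum_(i < n) excess u w i] `&`
   [set o | forall i, (i < n)%N -> z i o = w i]).
Proof.
have [mxi mz _] := run; apply: measurableI.
  by rewrite -[X in measurable X]setTI; apply: mxi => //; exact: measurable_dev_word.
rewrite (_ : [set o | _] = \bigcap_(i in [set i | (i < n)%N]) (z i @^-1` [set w i])).
  by apply: bigcap_measurableType => i _; exact: mz.
by apply/seteqP; split.
Qed.

Lemma measurable_dev n (a : R) (w0 : X) : measurable (dev n a).
Proof.
rewrite (devE _ _ w0); apply: bigsetU_measurable => t _.
exact: measurable_dev_cylinder.
Qed.

Lemma dev_prob_le n (a : R) (w0 : X) (x0 : S * A) : (P (dev n a) <= (expR (- a))%:E)%E.
Proof.
have [_ _ law] := run; rewrite (devE _ _ w0).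
apply: le_trans (measure_bigsetU_le _ _ _) _ => [t|]; first exact: measurable_dev_cylinder.
rewrite (eq_bigr (fun t : n.-tuple X =>
  \int[nu]_(u in [set u | (a <= \sum_(i < n) excess u (nth w0 t) i)%R])
     (\prod_(i < n) like u (nth w0 t) i)%:E)%E); last first.
  by move=> t _; apply: law; exact: measurable_dev_word.
pose F (t : n.-tuple X) u : R := (\prod_(i < n) like u (nth w0 t) i) *
     expR (\sum_(i < n) excess u (nth w0 t) i) * expR (- a).
have mF t : measurable_fun [set: U] (fun u => (F t u)%:E).
  apply/measurable_EFinP; apply: measurable_funM => //; apply: measurable_funM.
    exact: measurable_like.
  by apply: measurableT_comp => //; exact: measurable_excess.
have F0 t u : 0 <= F t u by rewrite /F !mulr_ge0 ?like_ge0 ?expR_ge0.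
apply: (@le_trans _ _ (\sum_(t : n.-tuple X) \int[nu]_u (F t u)%:E)%E).
  apply: lee_sum => t _.
  set B := [set u | _].
  have mB : measurable B by exact: measurable_dev_word.
  apply: (@le_trans _ _ (\int[nu]_(u in B) (F t u)%:E)%E).
    apply: ge0_le_integral => //.
    - by move=> u _; rewrite lee_fin like_ge0.
    - by apply/measurable_EFinP/measurable_funTS; exact: measurable_like.
    - exact/measurable_funTS/mF.
    (* Markov's inequality: on [B] the exponential of the total excess minus [a] is at least 1. *)
    - move=> u Bu; rewrite lee_fin /F -mulrA -expRD ler_peMr ?like_ge0//.
      by rewrite -expR0 ler_expR subr_ge0.
  by apply: ge0_subset_integral => // u _; rewrite lee_fin F0.
(* The exchange puts all words under one seed, where [sum_like_excess_le1] applies. *)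
rewrite -ge0_integral_sum//; last by move=> t u _; rewrite lee_fin F0.
apply: (@le_trans _ _ (\int[nu]_u (expR (- a))%:E)%E).
  apply: ge0_le_integral => //.
  - by move=> u _; rewrite sume_ge0// => t _; rewrite lee_fin F0.
  - exact: emeasurable_sum.
  - move=> u _; rewrite sumEFin lee_fin -mulr_suml ler_piMl ?expR_ge0//.
    exact: sum_like_excess_le1.
by rewrite integral_cst// [X in (_ * X)%E]probability_setT mule1.
Qed.

Lemma gain_deviation_whp (delta : R) (w0 : X) (x0 : S * A) : 0 < delta < 1 ->
  with_prob_ge P (1 - delta / 2) [set om | forall n, (0 < n)%N ->
    \sum_(i < n) value M (pl (xi om) (z^~ om) i) (reward (z^~ om) i) <=
    2 * \sum_(i < n) gain (reward (z^~ om) i) (z i om) + 4 * ln (4 * n%:R / delta)].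
Proof.
move=> /andP[d0 d1].
(* The inverse of [q n] is [delta / 2 * (1 / (n + 1) - 1 / (n + 2))], and these telescope to at most
   [delta / 2]. Index [n] stands for [n + 1] episodes. *)
pose q (n : nat) : R := 2 * (n.+1%:R * n.+2%:R) / delta.
have q0 n : 0 < q n by rewrite divr_gt0 ?mulr_gt0 ?ltr0n.
pose bad n := dev n.+1 (ln (q n)).
have mbad n : measurable (bad n) by exact: measurable_dev.
exists (~` \bigcup_n bad n); split.
- by apply: measurableC; exact: bigcup_measurable.
- move=> om good [//|n] _.
  have : \sum_(i < n.+1) excess (xi om) (z^~ om) i < ln (q n).
    by rewrite ltNge; apply/negP => devn; apply: good; exists n.
  (* With [a = n + 1], [2 * a * (a + 1) / delta] is at most the square of [4 * a / delta]. *)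
  have : ln (q n) <= 2 * ln (4 * n.+1%:R / delta).
    rewrite mulr_natl -lnXn ?divr_gt0 ?mulr_gt0 ?ltr0n//.
    rewrite ler_ln ?posrE ?exprn_gt0 ?divr_gt0 ?mulr_gt0 ?ltr0n//.
    rewrite /q -[n.+2%:R]natr1; have : 1 <= n.+1%:R :> R by rewrite ler1n.
    have : 1 <= delta^-1 by rewrite invf_ge1// ltW.
    move: n.+1%:R delta^-1 => a e a1 e1.
    have h1 : 0 <= a * (a - 1) * e by rewrite !mulr_ge0//; lra.
    have h2 : 0 <= a * a * e * (e - 1) by rewrite !mulr_ge0//; lra.
    have h3 : 0 <= a * a * e by rewrite !mulr_ge0//; lra.
    lra.
  rewrite sumrB -mulr_suml.
  move: (\sum_(i < _) value _ _ _) (\sum_(i < _) gain _ _) (ln _) (ln _) => *; lra.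
- rewrite probability_setC; last exact: bigcup_measurable.
  rewrite EFinB leeB//.
  apply: le_trans (generalized_Boole_inequality _ mbad _) _; first exact: bigcup_measurable.
  apply: lime_le; first exact: is_cvg_nneseries.
  apply: nearW => n.
  apply: (@le_trans _ _ (\sum_(0 <= i < n) (expR (- ln (q i)))%:E)%E).
    by apply: lee_sum => i _; exact: dev_prob_le.
  rewrite sumEFin lee_fin (eq_bigr (fun i : nat => delta / 2 * (i.+1%:R^-1 - i.+2%:R^-1))).
    rewrite -mulr_sumr ler_piMr ?divr_ge0 ?(ltW d0)//.
    rewrite (telescope_sumr_eq (fun i : nat => - i.+1%:R^-1))//; last by move=> i _; rewrite opprK addrC.
    by rewrite invr1 opprK addrC gerBl invr_ge0.
  move=> i _; rewrite expRN lnK ?posrE// /q.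
  by field; rewrite ?gt_eqF ?ltr0n//.
Qed.
End Deviation.

(** * The stopping time *)

Section StopTime.
Context {R : realType} {H : nat} {S A : finType} (M : mdp R H S A).
Variable c : hsa H S A -> R.

Lemma stop_time_covered (z : nat -> traj H S A) t :
  stop_time c z = t%:R%:E :> \bar R -> covered c (mkseq z t).
Proof.
rewrite /stop_time; have [[->]//|[n [[_ cn] -> _]] [nt]] :=
  ereal_inf_natP R (fun t => (0 < t)%N /\ covered c (mkseq z t)).
by have /eqP := nt; rewrite eqr_nat => /eqP <-.
Qed.

Lemma T1_ge1 delta Rl RP : (1 <= T1 M c delta Rl RP)%E.
Proof. by apply: le_ereal_inf_tmp => _ [n [n0 _] <-]; rewrite lee_fin ler1n. Qed.

(** Stopping is tested only after an episode, whence 1 and not 0. *)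
Lemma stop_time_supp0 (z : nat -> traj H S A) : supp c = finset.set0 ->
  (stop_time c z <= 1)%E.
Proof.
move=> c0; apply: ereal_inf_lbound; exists 1%N => //; split=> // x.
have : x \notin supp c by rewrite c0 inE.
by rewrite in_supp -leNgt => /le_trans; apply.
Qed.

Lemma phases_coverage_ge0 : (0 <= 64%:E * (nphases c)%:~R%:E * coverage M c)%E.
Proof.
by rewrite !mule_ge0 ?coverage_ge0// lee_fin// ler0z (le_trans _ (nphases_ge1 c)).
Qed.

(** If the coverage or [T1] is infinite, so is the right side. Otherwise [T1_cond] holds from [T1]
    on and bounds every later uncovered length. *)
Lemma stop_time_le delta (Rl RP : nat -> R) (z : nat -> traj H S A) :
  (forall n m, (0 < n <= m)%N -> T1_cond M c delta Rl RP n -> T1_cond M c delta Rl RP m) ->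
  (forall n phi, (0 < n)%N -> coverage M c = phi%:E -> T1_cond M c delta Rl RP n ->
     ~ covered c (mkseq z n) -> n%:R <= 24 * phi * (nphases c)%:~R - 2) ->
  (stop_time c z <= 64%:E * (nphases c)%:~R%:E * coverage M c + T1 M c delta Rl RP)%E.
Proof.
move=> T1up unc; have := phases_coverage_ge0; have := T1_ge1 delta Rl RP.
have cov0 := coverage_ge0 M c; have m1 := nphases_ge1 c.
case covE : (coverage M c) cov0 => [phi| |]// phi0; last first.
  move=> T11 _; rewrite -EFinM gt0_muley ?lte_fin ?mulr_gt0 ?ltr0z ?(lt_le_trans _ m1)//.
  by rewrite addye ?leey// gt_eqF// (lt_le_trans _ T11)// ltNyr.
rewrite /T1; have [[-> _] _ _|[n1 [[n10 T1n1] -> n1min]] _] :=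
    ereal_inf_natP R (fun n => (0 < n)%N /\ T1_cond M c delta Rl RP n).
  by rewrite -!EFinM addey ?leey.
rewrite -!EFinM -EFinD !lee_fin => phim0.
rewrite lee_fin in phi0; set m : R := (nphases c)%:~R in phim0 *.
have uncN n : (n1 <= n)%N -> ~ covered c (mkseq z n) -> n%:R <= 24 * phi * m - 2.
  move=> n1n; apply: unc => //; first exact: leq_trans n1n.
  by apply: T1up T1n1; rewrite n10.
have phm : 0 <= phi * m by rewrite mulr_ge0// ler0z (le_trans _ m1).
(* The successor appears because this is applied to the last uncovered length, one less than the
   stopping time. *)
have bound n : (n1 <= n)%N -> ~ covered c (mkseq z n) -> n.+1%:R <= 64 * m * phi + n1%:R.
  move=> n1n /(uncN _ n1n); have : 0 <= n1%:R :> R by [].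
  by rewrite -[n.+1%:R]natr1; move: n%:R n1%:R => *; lra.
rewrite /stop_time; have [[_ unct]|[t [[t0 ct] -> tmin]]] :=
    ereal_inf_natP R (fun t => (0 < t)%N /\ covered c (mkseq z t)).
  (* If the target were never covered, the length [n1 + 24 * b] with [phi * m < b] would violate
     [uncN]. *)
  exfalso; suff : 0 < 0 :> R by rewrite ltxx.
  have := archi_boundP phm; set b := Num.bound _ => phib.
  have := uncN (n1 + 24 * b)%N (leq_addr _ _) (fun cn => unct _ (conj (ltn_addr _ n10) cn)).
  rewrite natrD natrM; have : 0 <= n1%:R :> R by [].
  by move: phib; move: b%:R n1%:R => *; lra.
rewrite lee_fin; case: t t0 ct tmin => // t _ ct tmin.
have [tn1|n1t] := leqP t.+1 n1.
  by apply: le_trans (_ : n1%:R <= _); rewrite ?ler_nat// lerDr.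
apply: bound => // ct'; have := tmin t (conj _ ct').
by rewrite ltnn => tt; apply/notF/tt; exact: leq_trans n10 n1t.
Qed.
End StopTime.

(** * Intersection of the two high-probability events *)

Unset Implicit Arguments.

Theorem theorem3 (R : realType) (H : nat) (S A : finType) (M : mdp R H S A)
    (dU : measure_display) (U : measurableType dU) (nu : probability U R)
    (c : hsa H S A -> R) (delta : R)
    (Al : online_algo R H S A) (AP : rl_algo R H S A U)
    (Rl : nat -> R) (RP : R -> nat -> R)
    (Mreach : forall (h : 'I_H) (s : S), (0 < h)%N ->
       0 < sup [set occ_state M pi h s | pi in [set: policy R H S A]])
    (delta01 : 0 < delta < 1)
    (Rl_mono : {homo Rl : n m / (n <= m)%N >-> n <= m})
    (RP_mono : forall eps : R, 0 < eps < 1 ->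
       {homo RP eps : n m / (n <= m)%N >-> n <= m})
    (AP_meas : measurable_rl_algo AP)
    (Al_regret : online_regret c Al Rl)
    (AP_regret : forall eps : R, 0 < eps < 1 -> rl_regret M c nu AP eps (RP eps))
    (T1_cond_up : forall n m, (0 < n <= m)%N ->
       T1_cond M c delta Rl (RP (delta / 2)) n ->
       T1_cond M c delta Rl (RP (delta / 2)) m)
    (d : measure_display) (T : measurableType d) (P : probability T R)
    (xi : T -> U) (z : nat -> T -> traj H S A)
    (run : is_run M nu AP (delta / 2) (covgame c Al) P xi z) :
  with_prob_ge P (1 - delta) [set o |
    let tau := stop_time c (z^~ o) in
    (forall t : nat, tau = t%:R%:E -> covered c (mkseq (z^~ o) t)) /\
    (tau <= 64%:E * (nphases c)%:~R%:E * coverage M c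
            + T1 M c delta Rl (RP (delta / 2)%R))%E].
Proof.
(* [online_regret] concerns nonempty levels only. With nothing to cover, one episode suffices and
   [T1] is at least 1. *)
have [c0|c_supp] := eqVneq (supp c) finset.set0.
  exists setT; split=> //; last by rewrite probability_setT lee_fin gerBl; case/andP: delta01 => /ltW.
  move=> om _ /=; split; first exact: stop_time_covered.
  apply: le_trans (stop_time_supp0 _ c0) _; apply: le_trans (T1_ge1 M c delta Rl _) _.
  exact: leeDr (phases_coverage_ge0 M c).
have half01 : 0 < delta / 2 < 1 by move: delta01 => /andP[? ?]; apply/andP; split; lra.
have rew_dist := covgame_dist Al_regret c_supp.
have [x0 x0c] := finset.set0Pn _ c_supp.
(* An outcome exists because [P] has mass 1; it supplies a default trajectory. *)
have [om0 _] : [set: T] !=set0.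
  apply/set0P/eqP => T0; have := probability_setT P; rewrite T0 measure0 => /esym/eqP.
  by rewrite onee_eq0.
have := gain_deviation_whp rew_dist AP_meas run (z 0%N om0) (x0.1.2, x0.2) delta01.
have := AP_regret _ half01 _ _ _ _ _ _ rew_dist run.
(* Each of the two events is given half of the failure probability. *)
move=> whp_regret whp_dev; rewrite [X in 1 - X]splitr.
apply: with_prob_geI whp_regret whp_dev _ => om [reg dev] /=.
split; first exact: stop_time_covered.
apply: stop_time_le => // n phi n0 covE T1n unc.
exact: (@uncovered_episode_bound R H S A M c delta Al Rl (RP (delta / 2)) c_supp delta01
  Rl_mono (RP_mono _ half01) Al_regret (z^~ om)
  (played AP (delta / 2) (covgame c Al) (xi om) (z^~ om)) reg dev n phi n0 unc covE T1n).
Qed.
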